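(* Let $\Gamma$ be a symmetric multiset of cardinality $N$ and let $\tilde\Gamma\subseteq\Gamma$ be a symmetric sub-multiset of cardinality $M\le N$, with $M\equiv N \pmod 2$. Set $p=0$ if $N,M$ are even and $p=-\tfrac12$ if $N,M$ are odd. Let $k\ge0$, let $B:=B^{(k)}_{N,\Gamma}$ be the normalized exponential B-spline symbol, and let $G:=1/B$. Let $\vartheta_1,\dots,\vartheta_m$ be the distinct values of $\tilde\Gamma$ with multiplicities $\tau_1,\dots,\tau_m$ in $\tilde\Gamma$. Set $z_\ell:=e^{-\vartheta_\ell/2^{k+1}}$, $z_\ell^q:=e^{-q\vartheta_\ell/2^{k+1}}$ and $$v_{\ell,i}:=2z_\ell^{p-i}\prod_{r=0}^{i-1}(p-r).$$ Then there exists a unique Laurent polynomial $c$ with the following three properties: - $c$ is odd-symmetric, i.e. $c(z)=c(z^{-1})$; - its coefficients vanish outside $[-\lceil M/2\rceil+1,\ \lceil M/2\rceil-1]$; - for $\ell=1,\dots,m$ and $s=0,\dots,\tau_\ell-1$, $$\frac{d^s c}{dz^s}(z_\ell)=\sum_{i=0}^s\binom{s}{i}v_{\ell,i}\frac{d^{s-i}G}{dz^{s-i}}(z_\ell).$$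
   Context: $\mathbb{R}^+$ denotes the positive reals, and $\lceil L\rceil:=\min\{m\in\mathbb{Z}:m\ge L\}$. Symmetric multiset: a multiset $\Gamma=\{\gamma_1,\dots,\gamma_N\}$ of complex numbers is symmetric if there exist distinct $\theta_1,\dots,\theta_q\in\mathbb{R}^+\cup\mathrm{i}[0,\pi)$ and positive integers $t_1,\dots,t_q$ such that: - $\Gamma$ consists of $\theta_j$ and $-\theta_j$, each with multiplicity $t_j$; - when $N$ is odd, $\Gamma$ contains one additional element $0$. Non-normalized exponential B-spline symbol: for a multiset $\Lambda=\{\lambda_1,\dots,\lambda_L\}$, $$\tilde B^{(k)}_{L,\Lambda}(z):=z^{-\lceil L/2\rceil}\prod_{i=1}^L\big(e^{\lambda_i/2^{k+1}}z+1\big).$$ Normalized symbol (assume $N\ge2$): fix one value $\theta_j$ from the description of $\Gamma$ and set $B^{(k)}_{N,\Gamma}:=K^{(k)}\tilde B^{(k)}_{N,\Gamma}$, where: - for $N$ even, $(K^{(k)})^{-1}=(e^{-\theta_j/2^{k+1}}+e^{\theta_j/2^{k+1}})\,\tilde B^{(k)}_{N-2,\Gamma'}(e^{\theta_j/2^{k+1}})$, with $\Gamma'$ equal to $\Gamma$ minus one copy each of $\pm\theta_j$; - for $N$ odd, $(K^{(k)})^{-1}=(e^{-\theta_j/2^{k+2}}+e^{\theta_j/2^{k+2}})(e^{-\theta_j/2^{k+1}}+e^{\theta_j/2^{k+1}})\,\tilde B^{(k)}_{N-3,\Gamma''}(e^{\theta_j/2^{k+1}})$, with $\Gamma''$ equal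 to $\Gamma$ minus one copy each of $\theta_j,-\theta_j,0$. The polynomial $c$ of the theorem is denoted $c^{(k)}_{M,\Gamma}$. The exponential pseudo-spline symbol is $a^{(k)}_{M,N,\Gamma}:=B^{(k)}_{N,\Gamma}\,c^{(k)}_{M,\Gamma}$. *)

(* Defs.v *)
From Stdlib Require Import Reals Lra Lia ZArith Arith List Permutation.
Import ListNotations.
Open Scope R_scope.

Definition Cplx : Type := (R * R)%type.
Definition RtoC (x : R) : Cplx := (x, 0).
Definition C0 : Cplx := (0, 0).
Definition C1 : Cplx := (1, 0).
Definition Cadd (a b : Cplx) : Cplx := (fst a + fst b, snd a + snd b).
Definition Copp (a : Cplx) : Cplx := (- fst a, - snd a).
Definition Csub (a b : Cplx) : Cplx := Cadd a (Copp b).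
Definition Cmul (a b : Cplx) : Cplx :=
  (fst a * fst b - snd a * snd b, fst a * snd b + snd a * fst b).
Definition Cinv (a : Cplx) : Cplx :=
  (fst a / (fst a ^ 2 + snd a ^ 2), - snd a / (fst a ^ 2 + snd a ^ 2)).
Definition Cdiv (a b : Cplx) : Cplx := Cmul a (Cinv b).
Definition Cscal (r : R) (a : Cplx) : Cplx := (r * fst a, r * snd a).
Definition Cexp (a : Cplx) : Cplx := (exp (fst a) * cos (snd a), exp (fst a) * sin (snd a)).
Fixpoint Cpow (a : Cplx) (n : nat) : Cplx :=
  match n with O => C1 | S n' => Cmul a (Cpow a n') end.
Definition Czpow (a : Cplx) (n : Z) : Cplx :=
  match n with
  | Z0 => C1
  | Zpos p => Cpow a (Pos.to_nat p)
  | Zneg p => Cinv (Cpow a (Pos.to_nat p))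
  end.

Definition Ceq_dec (a b : Cplx) : {a = b} + {a <> b}.
Proof.
  destruct a as [a1 a2], b as [b1 b2].
  destruct (Req_EM_T a1 b1) as [e1|n1]; [|right; congruence].
  destruct (Req_EM_T a2 b2) as [e2|n2]; [left; congruence|right; congruence].
Defined.

Definition Cprod (l : list Cplx) : Cplx := fold_right Cmul C1 l.
Definition Csum_upto (n : nat) (f : nat -> Cplx) : Cplx :=
  fold_right Cadd C0 (map f (seq 0 (S n))).

Fixpoint remove_one (x : Cplx) (l : list Cplx) : list Cplx :=
  match l with
  | [] => []
  | y :: l' => if Ceq_dec x y then l' else y :: remove_one x l'
  end.
Definition mult (x : Cplx) (l : list Cplx) : nat := count_occ Ceq_dec l x.

Definition canon (th : Cplx) : Prop :=
  (0 < fst th /\ snd th = 0) \/ (fst th = 0 /\ 0 <= snd th < PI).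

Definition sym_expand (ths : list Cplx) (ts : list nat) (odd : bool) : list Cplx :=
  flat_map (fun pr => repeat (fst pr) (snd pr) ++ repeat (Copp (fst pr)) (snd pr))
           (combine ths ts)
  ++ (if odd then [C0] else []).

Definition sym_descr (G : list Cplx) (ths : list Cplx) (ts : list nat) : Prop :=
  length ths = length ts /\ NoDup ths /\ Forall canon ths /\
  Forall (fun t => (1 <= t)%nat) ts /\
  Permutation G (sym_expand ths ts (Nat.odd (length G))).

Definition symmetric_multiset (G : list Cplx) : Prop :=
  exists ths ts, sym_descr G ths ts.

Definition sub_multiset (A G : list Cplx) : Prop :=
  exists rest, Permutation G (A ++ rest).

Fixpoint padd (p q : list Cplx) : list Cplx :=
  match p, q with
  | [], _ => q
  | _, [] => p
  | a :: p', b :: q' => Cadd a b :: padd p' q'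
  end.
Definition pscale (c : Cplx) (p : list Cplx) : list Cplx := map (Cmul c) p.
Definition popp (p : list Cplx) : list Cplx := map Copp p.
Definition psub (p q : list Cplx) : list Cplx := padd p (popp q).
Fixpoint pmul (p q : list Cplx) : list Cplx :=
  match p with
  | [] => []
  | a :: p' => padd (pscale a q) (C0 :: pmul p' q)
  end.
Fixpoint pderiv_aux (n : nat) (p : list Cplx) : list Cplx :=
  match p with
  | [] => []
  | a :: p' => Cmul (RtoC (INR n)) a :: pderiv_aux (S n) p'
  end.
Definition pderiv (p : list Cplx) : list Cplx :=
  match p with [] => [] | _ :: p' => pderiv_aux 1 p' end.
Definition peval (p : list Cplx) (z : Cplx) : Cplx :=
  fold_right (fun a acc => Cadd a (Cmul z acc)) C0 p.
Definition monomial (n : nat) : list Cplx := repeat C0 n ++ [C1].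

Definition rat := (list Cplx * list Cplx)%type.
Definition rderiv (r : rat) : rat :=
  (psub (pmul (pderiv (fst r)) (snd r)) (pmul (fst r) (pderiv (snd r))),
   pmul (snd r) (snd r)).
Definition rderiv_n (s : nat) (r : rat) : rat := Nat.iter s rderiv r.
Definition reval (r : rat) (z : Cplx) : Cplx := Cdiv (peval (fst r) z) (peval (snd r) z).

Definition ceil_half (L : nat) : nat := ((L + 1) / 2)%nat.
Definition ex (j : nat) (lam : Cplx) : Cplx := Cexp (Cscal (/ 2 ^ j) lam).

Definition Btilde (k : nat) (Lam : list Cplx) (z : Cplx) : Cplx :=
  Cmul (Czpow z (- Z.of_nat (ceil_half (length Lam))))
       (Cprod (map (fun lam => Cadd (Cmul (ex (S k) lam) z) C1) Lam)).

(* normalising constant K^{(k)}, for the chosen value th of the description *)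
Definition Kinv (k : nat) (G : list Cplx) (th : Cplx) : Cplx :=
  let G' := remove_one (Copp th) (remove_one th G) in
  if Nat.even (length G) then
    Cmul (Cadd (ex (S k) (Copp th)) (ex (S k) th)) (Btilde k G' (ex (S k) th))
  else
    Cmul (Cmul (Cadd (ex (S (S k)) (Copp th)) (ex (S (S k)) th))
               (Cadd (ex (S k) (Copp th)) (ex (S k) th)))
         (Btilde k (remove_one C0 G') (ex (S k) th)).
Definition Kconst (k : nat) (G : list Cplx) (th : Cplx) : Cplx := Cinv (Kinv k G th).

Definition B_rat (k : nat) (G : list Cplx) (th : Cplx) : rat :=
  (pscale (Kconst k G th) (fold_right pmul [C1] (map (fun lam => [C1; ex (S k) lam]) G)),
   monomial (ceil_half (length G))).
Definition Ginv_rat (k : nat) (G : list Cplx) (th : Cplx) : rat :=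
  (snd (B_rat k G th), fst (B_rat k G th)).

Definition laurent_rat (L : nat) (cf : Z -> Cplx) : rat :=
  (map (fun i => cf (Z.of_nat i - (Z.of_nat L - 1))%Z) (seq 0 (2 * L - 1)),
   monomial (L - 1)).

Definition p_par (N : nat) : R := if Nat.even N then 0 else - / 2.
(* v_{l,i} = 2 z_l^{p-i} prod_{r=0}^{i-1} (p-r),  z_l^q = e^{-q vartheta/2^{k+1}} *)
Definition v_coef (k N : nat) (vth : Cplx) (i : nat) : Cplx :=
  Cscal (2 * fold_right Rmult 1 (map (fun r => p_par N - INR r) (seq 0 i)))
        (ex (S k) (Cscal (- (p_par N - INR i)) vth)).

(* Main.v *)
(* A Laurent polynomial c with the prescribed support is P(z) / z^(L-1) with
   deg P <= 2L-2, and the conditions at a node z_l say that P agrees with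
   2 z^p z^(L-1) / B to order tau_l there. Since deg P < M, the M conditions
   determine P, which gives uniqueness. For existence, interpolate by some P of
   degree < M. The condition at a node is equivalent to a polynomial congruence
   for the square, (P Q)^2 = 4 z^(N+2L-2) mod (z - z_l)^tau_l, where Q is the
   numerator of B, together with the value of P Q at z_l; squaring removes the
   branch z^(-1/2) occurring for odd N. As Q is palindromic and the nodes are
   closed under inversion, this system is invariant under reversal of
   coefficients, so the reversal of P interpolates the same data. For odd M it
   therefore equals P. For even M the difference of z P and its reversal is a
   multiple of the monic node polynomial, whose constant term is 1, while the
   extreme coefficients of the difference are opposite; so it vanishes too. *)
Require Import Defs.
From Stdlib Require Import Reals ZArith Arith List Permutation.
From Stdlib Require Import Lra Lia.
From HB Require structures.
From mathcomp Require all_boot all_algebra boolp Rstruct ring zify.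
(* Reals also defines C1. *)
Import Defs.
Import ListNotations.
Open Scope R_scope.

(** * The complex exponential and symmetric multisets *)

(** The predicate [P] of the final theorem up to conversion, named so that existence and uniqueness
    can be argued about it inside the MathComp module. *)
Definition pseudospline_conditions (k : nat) (Gam Gt : list Cplx) (th : Cplx)
    (cf : Z -> Cplx) : Prop :=
  let L := ceil_half (length Gt) in
  (forall z, z <> C0 ->
     reval (laurent_rat L cf) z = reval (laurent_rat L cf) (Cinv z)) /\
  (forall n : Z, (n < - Z.of_nat L + 1 \/ Z.of_nat L - 1 < n)%Z -> cf n = C0) /\
  (forall vth : Cplx, forall s : nat, (s < mult vth Gt)%nat ->
     reval (rderiv_n s (laurent_rat L cf)) (ex (S k) (Copp vth)) =
     Csum_upto s (fun i =>
       Cmul (RtoC (Binomial.C s i))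
         (Cmul (v_coef k (length Gam) vth i)
            (reval (rderiv_n (s - i) (Ginv_rat k Gam th)) (ex (S k) (Copp vth)))))).

Ltac Cplx_ring :=
  intros; unfold Cadd, Cmul, Copp, Cscal, C0, C1, RtoC; simpl;
  apply injective_projections; simpl; ring.

Lemma Cadd_assoc a b c : Cadd a (Cadd b c) = Cadd (Cadd a b) c.
Proof. Cplx_ring. Qed.
Lemma Cadd_comm a b : Cadd a b = Cadd b a.
Proof. Cplx_ring. Qed.
Lemma Cadd_0l a : Cadd C0 a = a.
Proof. Cplx_ring. Qed.
Lemma Cadd_opp_l a : Cadd (Copp a) a = C0.
Proof. Cplx_ring. Qed.
Lemma Cmul_assoc a b c : Cmul a (Cmul b c) = Cmul (Cmul a b) c.
Proof. Cplx_ring. Qed.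
Lemma Cmul_comm a b : Cmul a b = Cmul b a.
Proof. Cplx_ring. Qed.
Lemma Cmul_1l a : Cmul C1 a = a.
Proof. Cplx_ring. Qed.
Lemma Cmul_add_l a b c : Cmul (Cadd a b) c = Cadd (Cmul a c) (Cmul b c).
Proof. Cplx_ring. Qed.

Lemma C1_neq_C0 : C1 <> C0.
Proof. intros H; injection H; lra. Qed.

Lemma Cinv_l a : a <> C0 -> Cmul (Cinv a) a = C1.
Proof.
  destruct a as [x y]; intros Ha.
  assert (x ^ 2 + y ^ 2 <> 0).
  { intros H; apply Ha; unfold C0; f_equal; nra. }
  unfold Cmul, Cinv, C1; simpl in *; apply injective_projections; simpl; field;
    simpl in *; lra.
Qed.

(** Both components are quotients with numerator zero. The MathComp field structure requires this
    value. *)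
Lemma Cinv_C0 : Cinv C0 = C0.
Proof. unfold Cinv, C0; simpl; apply injective_projections; simpl; lra. Qed.

Lemma Cmul_integral a b : Cmul a b = C0 -> a = C0 \/ b = C0.
Proof.
  intros H; destruct (Ceq_dec a C0) as [|Ha]; [now left|right].
  rewrite <- (Cmul_1l b), <- (Cinv_l a Ha), <- Cmul_assoc, H; Cplx_ring.
Qed.

Lemma Cmul_neq_C0 a b : a <> C0 -> b <> C0 -> Cmul a b <> C0.
Proof. intros Ha Hb H; apply Cmul_integral in H as []; contradiction. Qed.

Lemma RtoC_add x y : RtoC (x + y) = Cadd (RtoC x) (RtoC y).
Proof. Cplx_ring. Qed.

Lemma Cexp_add a b : Cexp (Cadd a b) = Cmul (Cexp a) (Cexp b).
Proof.
  unfold Cexp, Cadd, Cmul; simpl; rewrite exp_plus, cos_plus, sin_plus.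
  apply injective_projections; simpl; ring.
Qed.

Lemma Cexp_C0 : Cexp C0 = C1.
Proof. unfold Cexp, C0, C1; simpl; now rewrite exp_0, cos_0, sin_0, !Rmult_1_l. Qed.

Lemma ex_add j a b : ex j (Cadd a b) = Cmul (ex j a) (ex j b).
Proof. unfold ex; rewrite <- Cexp_add; f_equal; Cplx_ring. Qed.

Lemma ex_C0 j : ex j C0 = C1.
Proof. unfold ex; rewrite <- Cexp_C0; f_equal; Cplx_ring. Qed.

Lemma ex_opp_mul j a : Cmul (ex j (Copp a)) (ex j a) = C1.
Proof. now rewrite <- ex_add, Cadd_opp_l, ex_C0. Qed.

Lemma ex_neq_C0 j a : ex j a <> C0.
Proof.
  intros H; apply C1_neq_C0; rewrite <- (ex_opp_mul j a), H; Cplx_ring.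
Qed.

Lemma ex_half j a : ex (S j) (Cscal 2 a) = ex j a.
Proof.
  unfold ex; apply f_equal; unfold Cscal; simpl; apply injective_projections; simpl;
    field; apply pow_nonzero; lra.
Qed.

Lemma ex_succ_sqr j a : Cmul (ex (S j) a) (ex (S j) a) = ex j a.
Proof. rewrite <- ex_add, <- (ex_half j a); f_equal; Cplx_ring. Qed.

(** The half-angle formula forces [sin (x / 2) = 0], and [sin] is positive between 0 and [PI]. *)
Lemma cos_eq_1_small x : - (2 * PI) < x < 2 * PI -> cos x = 1 -> x = 0.
Proof.
  intros Hx Hc; pose proof PI_RGT_0.
  assert (Hs : sin (x / 2) = 0).
  { assert (E : cos x = 1 - 2 * sin (x / 2) * sin (x / 2)).
    { rewrite <- cos_2a_sin; f_equal; field. }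
    nra. }
  destruct (Rtotal_order x 0) as [H0|[H0|H0]]; trivial.
  - pose proof (sin_gt_0 (- (x / 2))) as Hp; rewrite sin_neg in Hp; lra.
  - pose proof (sin_gt_0 (x / 2)); lra.
Qed.

Lemma pow2_ge_2 k : 2 <= 2 ^ S k.
Proof. pose proof (pow_R1_Rle 2 k); simpl; lra. Qed.

Lemma inv_pow2_scale_lt k x c : - c < x < c ->
  - (c / 2) < / 2 ^ S k * x < c / 2.
Proof.
  intros Hx; pose proof (pow2_ge_2 k) as H2.
  assert (H : / 2 ^ S k * 2 ^ S k = 1) by (apply Rinv_l; lra).
  assert (0 < / 2 ^ S k) by (apply Rinv_0_lt_compat; lra).
  set (u := / 2 ^ S k) in *; clearbody u.
  assert (u <= 1 / 2) by nra.
  split; nra.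
Qed.

Lemma Cexp_eq_C1 a : - (2 * PI) < snd a < 2 * PI -> Cexp a = C1 -> a = C0.
Proof.
  destruct a as [x y]; unfold Cexp, C1, C0; simpl; intros Hy H; injection H as Hc Hs.
  pose proof (exp_pos x); pose proof (sin2_cos2 y) as E; unfold Rsqr in E.
  assert (sin y = 0) by nra.
  assert (0 < cos y) by nra.
  assert (Hcos : cos y = 1) by nra.
  assert (y = 0) by now apply cos_eq_1_small.
  assert (E1 : exp x = exp 0) by (rewrite exp_0, <- Hc, Hcos; ring).
  apply exp_inv in E1; congruence.
Qed.

Lemma ex_inj k a b : - PI < snd a < PI -> - PI < snd b < PI ->
  ex (S k) a = ex (S k) b -> a = b.
Proof.
  intros Ha Hb H; pose proof PI_RGT_0.
  assert (E : ex (S k) (Cadd (Copp b) a) = C1).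
  { now rewrite ex_add, H, ex_opp_mul. }
  unfold ex in E; apply Cexp_eq_C1 in E.
  - pose proof (pow2_ge_2 k); assert (/ 2 ^ S k <> 0) by (apply Rinv_neq_0_compat; lra).
    destruct a as [a1 a2], b as [b1 b2]; unfold Cscal, Cadd, Copp, C0 in E.
    injection E as E1 E2; simpl in *; f_equal; nra.
  - destruct (inv_pow2_scale_lt k (snd (Cadd (Copp b) a)) (2 * PI));
      unfold Cscal, Cadd, Copp in *; cbn [fst snd] in *; lra.
Qed.

(** If the exponential were -1, its square would be 1. The doubled exponent still has imaginary part
    between -2 pi and 2 pi, so it is 0, and then the exponential itself is 1. *)
Lemma ex_add_C1_neq_C0 k a : - (2 * PI) < snd a < 2 * PI ->
  Cadd (ex (S k) a) C1 <> C0.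
Proof.
  intros Ha H; pose proof PI_RGT_0.
  assert (E : Cexp (Cscal 2 (Cscal (/ 2 ^ S k) a)) = C1).
  { replace (Cscal 2 (Cscal (/ 2 ^ S k) a))
      with (Cadd (Cscal (/ 2 ^ S k) a) (Cscal (/ 2 ^ S k) a)) by Cplx_ring.
    rewrite Cexp_add; change (Cmul (ex (S k) a) (ex (S k) a) = C1).
    replace (ex (S k) a) with (Copp C1); [Cplx_ring|].
    rewrite <- (Cadd_0l (Copp C1)), <- H; Cplx_ring. }
  apply Cexp_eq_C1 in E.
  - assert (E0 : Cscal (/ 2 ^ S k) a = C0).
    { revert E; unfold Cscal, C0; set (u := / 2 ^ S k); clearbody u; cbn [fst snd].
      intros E; injection E as E1 E2; f_equal; lra. }
    unfold ex in H; rewrite E0, Cexp_C0 in H; unfold Cadd, C1, C0 in H.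
    injection H; lra.
  - destruct (inv_pow2_scale_lt k (snd a) (2 * PI)); unfold Cscal; cbn [fst snd]; lra.
Qed.

Lemma sym_expand_opp ths ts b :
  Permutation (map Copp (sym_expand ths ts b)) (sym_expand ths ts b).
Proof.
  assert (Copp_inv : forall x, Copp (Copp x) = x).
  { intros [x y]; unfold Copp; simpl; f_equal; ring. }
  assert (map_rep : forall x n, map Copp (repeat x n) = repeat (Copp x) n).
  { intros x n; induction n; simpl; congruence. }
  unfold sym_expand; rewrite map_app; apply Permutation_app.
  - induction (combine ths ts) as [|[x n] l IH]; simpl; [constructor|].
    rewrite map_app, map_app, !map_rep, Copp_inv.
    apply Permutation_app; [apply Permutation_app_comm|exact IH].
  - destruct b; simpl; [|constructor].
    replace (Copp C0) with C0; [reflexivity|Cplx_ring].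
Qed.

(** Symmetry enters the interpolation through this closure under negation, which pairs each node
    with its inverse, and through the strip bound below. *)
Lemma symmetric_multiset_opp G :
  symmetric_multiset G -> Permutation (map Copp G) G.
Proof.
  intros (ths & ts & _ & _ & _ & _ & H).
  eapply perm_trans; [apply Permutation_map, H|].
  eapply perm_trans; [apply sym_expand_opp|symmetry; exact H].
Qed.

Lemma canon_snd_bounds x : canon x -> - PI < snd x < PI.
Proof. pose proof PI_RGT_0; intros [[]|[]]; lra. Qed.

Lemma symmetric_multiset_snd_bounds G x :
  symmetric_multiset G -> In x G -> - PI < snd x < PI.
Proof.
  pose proof PI_RGT_0; intros (ths & ts & _ & _ & Hc & _ & HP) Hx.
  apply (Permutation_in _ HP), in_app_or in Hx as [Hx|Hx].
  - apply in_flat_map in Hx as ([u n] & Hun & Hx).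
    apply in_combine_l in Hun; rewrite Forall_forall in Hc.
    specialize (canon_snd_bounds _ (Hc _ Hun)) as Hu.
    apply in_app_or in Hx as [Hx|Hx]; apply repeat_spec in Hx; subst x; simpl; lra.
  - destruct (Nat.odd (length G)); [destruct Hx as [<-|[]]; simpl; lra|contradiction].
Qed.

Lemma in_remove_one x y l : In y (remove_one x l) -> In y l.
Proof.
  induction l as [|z l IH]; simpl; trivial.
  destruct (Ceq_dec x z); simpl; tauto.
Qed.

Lemma Cpow_neq_C0 a n : a <> C0 -> Cpow a n <> C0.
Proof.
  intros Ha; induction n; simpl; [exact C1_neq_C0|].
  intros H; apply Cmul_integral in H as []; tauto.
Qed.

Lemma Cinv_neq_C0 a : a <> C0 -> Cinv a <> C0.
Proof.
  intros Ha H; apply C1_neq_C0; rewrite <- (Cinv_l a Ha), H; Cplx_ring.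
Qed.

Lemma Czpow_neq_C0 a n : a <> C0 -> Czpow a n <> C0.
Proof.
  destruct n; simpl; intros; auto using C1_neq_C0, Cpow_neq_C0, Cinv_neq_C0.
Qed.

(** Each factor is [ex (S k)] of the sum of [x] and [th], plus 1, and the imaginary part of that sum
    stays between -2 pi and 2 pi. *)
Lemma Btilde_neq_C0 k l th : - PI < snd th < PI ->
  (forall x, In x l -> - PI < snd x < PI) -> Btilde k l (ex (S k) th) <> C0.
Proof.
  intros Hth Hl; unfold Btilde; intros H; apply Cmul_integral in H as [H|H].
  - revert H; apply Czpow_neq_C0, ex_neq_C0.
  - revert Hl H; generalize l as m; induction m as [|x m IH]; simpl.
    + intros _; exact C1_neq_C0.
    + intros Hm H; apply Cmul_integral in H as [H|H]; [|now apply IH; auto].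
      revert H; rewrite <- ex_add; apply ex_add_C1_neq_C0.
      pose proof (Hm x (or_introl eq_refl)); simpl; lra.
Qed.

Lemma ex_opp_add_neq_C0 k th : - PI < snd th < PI ->
  Cadd (ex (S k) (Copp th)) (ex (S k) th) <> C0.
Proof.
  intros Hth H.
  assert (E : Cmul (ex (S k) th) (Cadd (ex (S k) (Copp th)) (ex (S k) th))
              = Cadd (ex (S k) (Cadd th th)) C1).
  { rewrite ex_add, <- (ex_opp_mul (S k) th); Cplx_ring. }
  apply (ex_add_C1_neq_C0 k (Cadd th th)); [simpl; lra|].
  rewrite <- E, H; Cplx_ring.
Qed.

Lemma Kconst_neq_C0 k G th : - PI < snd th < PI ->
  (forall x, In x G -> - PI < snd x < PI) -> Kconst k G th <> C0.
Proof.
  intros Hth HG; unfold Kconst, Kinv; apply Cinv_neq_C0; cbv zeta.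
  case (Nat.even _); apply Cmul_neq_C0; [| |apply Cmul_neq_C0|];
    try (apply ex_opp_add_neq_C0; exact Hth); apply Btilde_neq_C0; trivial;
    intros x Hx; apply HG; repeat apply in_remove_one in Hx; exact Hx.
Qed.

(* The derivatives at e^(-x / 2^(k+1)) of the branch of z^p determined by x. *)
Definition power_jet (k N : nat) (x : Cplx) (i : nat) : Cplx :=
  Cscal (fold_right Rmult 1 (map (fun r => p_par N - INR r) (seq 0 i)))
        (ex (S k) (Cscal (- (p_par N - INR i)) x)).

Lemma v_coef_power_jet k N x i :
  v_coef k N x i = Cmul (RtoC 2) (power_jet k N x i).
Proof. unfold v_coef, power_jet; Cplx_ring. Qed.

(** For odd [N] the exponent [x] fixes the branch: the value of z^(-1/2) is the inverse of the
    square root [ex (S (S k)) (Copp x)] of the node. *)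
Lemma power_jet_0 k N x : power_jet k N x 0 =
  if Nat.even N then C1 else Cinv (ex (S (S k)) (Copp x)).
Proof.
  unfold power_jet, p_par; simpl fold_right; destruct (Nat.even N).
  - replace (Cscal (- (0 - INR 0)) x) with C0 by Cplx_ring.
    rewrite ex_C0; Cplx_ring.
  - rewrite <- (ex_half (S k)).
    replace (Cscal 2 (Cscal (- (- / 2 - INR 0)) x)) with x
      by (unfold Cscal; simpl; apply injective_projections; simpl; field).
    rewrite <- (Cmul_1l (Cinv _)), <- (ex_opp_mul (S (S k)) x), (Cmul_comm _ (ex _ x)).
    rewrite <- Cmul_assoc, (Cmul_comm _ (Cinv _)), Cinv_l by apply ex_neq_C0.
    Cplx_ring.
Qed.

(** The equation z f' = p f for f = z^p, differentiated [i] times. Both sides are doubled so that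
    the coefficient is an integer also for p = -1/2. *)
Lemma power_jet_succ k N x i :
  Cmul (Cmul (RtoC 2) (ex (S k) (Copp x))) (power_jet k N x (S i)) =
  Cmul (RtoC (2 * p_par N - 2 * INR i)) (power_jet k N x i).
Proof.
  unfold power_jet; rewrite seq_S, map_app, fold_right_app; simpl fold_right.
  assert (fold_mul : forall l c, fold_right Rmult c l = fold_right Rmult 1 l * c).
  { induction l as [|r l IH]; intros c; simpl; [ring|rewrite IH; ring]. }
  rewrite fold_mul.
  replace (ex (S k) (Cscal (- (p_par N - INR i)) x)) with
    (Cmul (ex (S k) (Copp x)) (ex (S k) (Cscal (- (p_par N - INR (S i))) x))).
  - Cplx_ring.
  - rewrite <- ex_add; f_equal; rewrite S_INR; Cplx_ring.
Qed.

(** * Parity, binomials and coefficient families with bounded support *)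

Lemma ceil_half_spec n :
  (n + (if Nat.even n then 0 else 1) = 2 * ceil_half n)%nat.
Proof.
  unfold ceil_half; destruct (Nat.even n) eqn:E.
  - apply Nat.even_spec in E as [m ->].
    replace (2 * m + 1)%nat with (1 + m * 2)%nat by lia.
    rewrite Nat.div_add by lia; simpl; lia.
  - rewrite <- Nat.negb_odd in E; apply Bool.negb_false_iff, Nat.odd_spec in E as [m ->].
    replace (2 * m + 1 + 1)%nat with ((m + 1) * 2)%nat by lia.
    rewrite Nat.div_mul by lia; lia.
Qed.

(** Any natural number with the factorial identity is accepted, so that the MathComp binomial can be
    substituted for [c]. *)
Lemma binomial_INR s i c :
  (c * (fact i * fact (s - i)) = fact s)%nat -> Binomial.C s i = INR c.
Proof.
  intros H; unfold Binomial.C; rewrite <- H, !mult_INR; field.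
  split; apply INR_fact_neq_0.
Qed.

Lemma two_p_par N i :
  2 * p_par N - 2 * INR i = - INR ((if Nat.even N then 0 else 1) + 2 * i).
Proof.
  unfold p_par; rewrite plus_INR, mult_INR; destruct (Nat.even N); simpl; field.
Qed.

(** Undoes the index shift by [L - 1] in [laurent_rat], with value zero off the prescribed
    support. *)
Definition laurent_coef (L : nat) (f : nat -> Cplx) (n : Z) : Cplx :=
  if ((1 - Z.of_nat L <=? n) && (n <=? Z.of_nat L - 1))%Z%bool
  then f (Z.to_nat (n + (Z.of_nat L - 1))) else C0.

Lemma laurent_coef_out L f n :
  (n < - Z.of_nat L + 1 \/ Z.of_nat L - 1 < n)%Z -> laurent_coef L f n = C0.
Proof.
  intros H; unfold laurent_coef.
  destruct (Z.leb_spec (1 - Z.of_nat L) n); trivial.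
  destruct (Z.leb_spec n (Z.of_nat L - 1)); trivial; lia.
Qed.

Lemma laurent_coef_nth L f i : (i < 2 * L - 1)%nat ->
  laurent_coef L f (Z.of_nat i - (Z.of_nat L - 1)) = f i.
Proof.
  intros H; unfold laurent_coef.
  destruct (Z.leb_spec (1 - Z.of_nat L) (Z.of_nat i - (Z.of_nat L - 1))); [|lia].
  destruct (Z.leb_spec (Z.of_nat i - (Z.of_nat L - 1)) (Z.of_nat L - 1)); [|lia].
  simpl; f_equal; lia.
Qed.

Lemma laurent_support_ext L cf cf' :
  (forall n, (n < - Z.of_nat L + 1 \/ Z.of_nat L - 1 < n)%Z -> cf n = C0) ->
  (forall n, (n < - Z.of_nat L + 1 \/ Z.of_nat L - 1 < n)%Z -> cf' n = C0) ->
  (forall i, (i < 2 * L - 1)%nat -> cf (Z.of_nat i - (Z.of_nat L - 1))%Z =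
                                   cf' (Z.of_nat i - (Z.of_nat L - 1))%Z) ->
  forall n, cf n = cf' n.
Proof.
  intros H H' Hi n.
  destruct (Z.lt_ge_cases n (- Z.of_nat L + 1)); [rewrite H, H'; auto|].
  destruct (Z.lt_ge_cases (Z.of_nat L - 1) n); [rewrite H, H'; auto|].
  replace n with (Z.of_nat (Z.to_nat (n + (Z.of_nat L - 1))) - (Z.of_nat L - 1))%Z by lia.
  apply Hi; lia.
Qed.

(** For exponents in this strip distinct entries give distinct nodes, and the product of
    [ex (S k) u] and a node is never -1, so the symbol does not vanish at the nodes. *)
Definition in_strip (l : list Cplx) : Prop :=
  forall x, In x l -> - PI < snd x < PI.

Lemma in_strip_node_inj k l x u : in_strip l -> In x l -> In u l ->
  ex (S k) (Copp x) = ex (S k) (Copp u) -> x = u.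
Proof.
  intros Hl Hx Hu H; apply Hl in Hx; apply Hl in Hu.
  apply ex_inj in H; [|simpl; lra|simpl; lra].
  destruct x as [x1 x2], u as [u1 u2]; injection H; intros; f_equal; lra.
Qed.

Lemma in_strip_factor_neq_C0 k l x u : in_strip l -> In x l -> In u l ->
  Cadd (Cmul (ex (S k) u) (ex (S k) (Copp x))) C1 <> C0.
Proof.
  intros Hl Hx Hu; apply Hl in Hx; apply Hl in Hu.
  rewrite <- ex_add; apply ex_add_C1_neq_C0; simpl; lra.
Qed.

Lemma sub_multiset_incl A G : sub_multiset A G -> incl A G.
Proof.
  intros [rest HP] x Hx; apply (Permutation_in _ (Permutation_sym HP)).
  apply in_or_app; now left.
Qed.

Lemma symmetric_multiset_in_strip G : symmetric_multiset G -> in_strip G.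
Proof. intros HG x; now apply symmetric_multiset_snd_bounds. Qed.

(* Keeps the MathComp notations out of the scopes of the main theorem. *)
Module PseudoSpline.
Import structures all_boot all_algebra Rstruct ring zify.
Import GRing.Theory.
Set Implicit Arguments. Unset Strict Implicit. Unset Printing Implicit Defensive.
Local Open Scope ring_scope.

(** * Local congruences and reversal of polynomials *)

Section PolyInterpolation.
Variable F : fieldType.
Implicit Types (p q : {poly F}) (a b x : F).

Lemma coprimep_prod (I : eqType) (s : seq I) (m : I -> {poly F}) p :
  {in s, forall i, coprimep p (m i)} -> coprimep p (\prod_(i <- s) m i).
Proof.
move=> cop; rewrite big_seq; elim/big_ind: _ => //; first exact: coprimep1.
by move=> u v cu cv; rewrite coprimepMr cu cv.
Qed.

Lemma dvdp_prod_coprime (I : eqType) (s : seq I) (m : I -> {poly F}) p :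
  uniq s -> {in s &, forall i j, i != j -> coprimep (m i) (m j)} ->
  {in s, forall i, m i %| p} -> \prod_(i <- s) m i %| p.
Proof.
elim: s => [|i s IHs] /=; first by rewrite big_nil dvd1p.
move=> /andP[iNs us] cop dvd; rewrite big_cons Gauss_dvdp.
  rewrite dvd ?mem_head //=; apply: IHs => // [j k js ks|j js].
    by apply: cop; rewrite inE ?js ?ks orbT.
  by apply: dvd; rewrite inE js orbT.
apply: coprimep_prod => j js; apply: cop; rewrite ?mem_head //.
  by rewrite inE js orbT.
by apply: contraNneq iNs => ->.
Qed.

Lemma poly_chinese (I : eqType) (s : seq I) (m h : I -> {poly F}) :
  uniq s -> {in s &, forall i j, i != j -> coprimep (m i) (m j)} ->
  exists p, {in s, forall i, m i %| p - h i}.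
Proof.
elim: s => [|i s IHs] /=; first by exists 0.
move=> /andP[iNs us] cop; case: IHs => // [j k js ks|p hp].
  by apply: cop; rewrite inE ?js ?ks orbT.
have cop_i : coprimep (m i) (\prod_(j <- s) m j).
  apply: coprimep_prod => j js; apply: cop; rewrite ?mem_head //.
    by rewrite inE js orbT.
  by apply: contraNneq iNs => ->.
have [[u v] /= uv] := Bezout_eq1_coprimepP _ _ cop_i.
(* By Bezout the factor in front of [h i - p] is 1 modulo [m i] and 0 modulo the other moduli: the
   residue at [i] is corrected and the others are kept. *)
exists (p + v * \prod_(j <- s) m j * (h i - p)) => j.
rewrite inE => /predU1P[->|js].
  have -> : p + v * \prod_(j <- s) m j * (h i - p) - h i = u * m i * (p - h i).
    have -> : v * \prod_(j <- s) m j = 1 - u * m i by apply: (addrI (u * m i)); rewrite uv; ring.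
    by ring.
  by rewrite -mulrA mulrCA dvdp_mulIl.
have -> : p + v * \prod_(j <- s) m j * (h i - p) - h j =
    p - h j + v * (h i - p) * \prod_(j <- s) m j by ring.
rewrite dvdp_add ?hp // dvdp_mull // (perm_big _ (perm_to_rem js)) big_cons.
by rewrite dvdp_mulIl.
Qed.

Lemma coprimep_XsubC_expr a p n : p.[a] != 0 -> coprimep (('X - a%:P) ^+ n) p.
Proof.
by move=> pa; apply: coprimep_expl; rewrite coprimep_sym coprimep_XsubC rootE.
Qed.

Lemma dvdp_deriv_XsubC_exp p a n :
  ('X - a%:P) ^+ n.+1 %| p -> ('X - a%:P) ^+ n %| p^`().
Proof.
case/dvdpP=> q ->; rewrite derivM deriv_exp derivXsubC /= mul1r -mulr_natr.
by rewrite dvdp_add //; [rewrite exprS mulrA | rewrite mulrCA]; rewrite ?dvdp_mulIr ?dvdp_mulIl.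
Qed.

Lemma horner_dvdp_XsubC_exp p a n :
  (0 < n)%N -> ('X - a%:P) ^+ n %| p -> p.[a] = 0.
Proof.
case: n => // n _ dvd; apply/polyXsubCP/(dvdp_trans _ dvd).
by rewrite exprS dvdp_mulIl.
Qed.

(** The reciprocal polynomial x^d p(1/x), taken for a prescribed bound [d] and not for the actual
    degree, so that vanishing leading coefficients do no harm. *)
Definition revp (d : nat) p := \poly_(i < d.+1) p`_(d - i).

Lemma horner_revp d p x :
  (size p <= d.+1)%N -> x != 0 -> (revp d p).[x] = x ^+ d * p.[x^-1].
Proof.
move=> sp x0; rewrite horner_poly (horner_coef_wide _ sp) mulr_sumr.
rewrite (reindex_inj rev_ord_inj) /=; apply: eq_bigr => i _.
have le_id : (i <= d)%N by rewrite -ltnS.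
rewrite subSS subKn // mulrCA; congr (_ * _).
by rewrite expfB_cond ?(negPf x0) ?add0n // exprVn.
Qed.

Lemma size_revp d p : (size (revp d p) <= d.+1)%N.
Proof. exact: size_poly. Qed.

(** * Reciprocal polynomials and jets in characteristic zero *)

Section CharacteristicZero.
Hypothesis F0 : [pchar F] =i pred0.

Lemma natrS_neq0 n : n.+1%:R != 0 :> F.
Proof. by have /pcharf0P -> := F0. Qed.

(** The integers 1, 2, 3, ... are distinct and nonzero in characteristic zero, which gives a nonzero
    difference too many roots. *)
Lemma poly_eq_off0 p q : (forall x, x != 0 -> p.[x] = q.[x]) -> p = q.
Proof.
move=> eq_pq; apply/eqP; rewrite -subr_eq0; apply: contraT => nz.
have := max_poly_roots nz (rs := [seq i.+1%:R | i <- iota 0 (size (p - q))]).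
rewrite size_map size_iota ltnn; apply.
  apply/allP=> _ /mapP[i _ ->]; rewrite rootE hornerD hornerN.
  by rewrite eq_pq ?subrr ?natrS_neq0.
rewrite map_inj_uniq ?iota_uniq // => i j /eqP.
wlog le_ij : i j / (i <= j)%N.
  move=> wl; case/orP: (leq_total i j) => [/wl//|/wl wl' e].
  by apply/esym/wl'; rewrite eq_sym.
rewrite -(subnKC le_ij) -addSn natrD -subr_eq0 opprD addNKr oppr_eq0.
by have /pcharf0P -> := F0 => /eqP->; rewrite addn0.
Qed.

Lemma revpM d e p q : (size p <= d.+1)%N -> (size q <= e.+1)%N ->
  revp (d + e) (p * q) = revp d p * revp e q.
Proof.
move=> sp sq; apply: poly_eq_off0 => x x0.
have spq : (size (p * q)%R <= (d + e).+1)%N.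
  by apply: leq_trans (size_polyMleq _ _) _; lia.
by rewrite hornerM !horner_revp // hornerM exprD mulrACA.
Qed.

(** Reversal is multiplicative once the degree bound is split as [d - n] plus [n], and it sends (X -
    b)^n to (-b)^n (X - 1/b)^n. *)
Lemma dvdp_revp d p b n : b != 0 -> (size p <= d.+1)%N ->
  ('X - b%:P) ^+ n %| p -> ('X - b^-1%:P) ^+ n %| revp d p.
Proof.
move=> b0 sp /dvdpP[q pE].
have [q0|q0] := eqVneq q 0.
  rewrite pE q0 mul0r (_ : revp _ _ = 0) ?dvdp0 //.
  by apply/polyP=> i; rewrite coef_poly !coef0 if_same.
have m_neq0 : ('X - b%:P) ^+ n != 0 by rewrite expf_neq0 ?polyXsubC_eq0.
have szE : (size q + n <= d.+1)%N.
  by move: sp; rewrite pE size_Mmonic ?monic_exp ?monicXsubC // size_exp_XsubC addnS.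
have szq : (0 < size q)%N by rewrite size_poly_gt0.
have -> : d = (d - n + n)%N by lia.
rewrite pE revpM ?size_exp_XsubC; [|lia|lia].
rewrite dvdp_mull // (_ : revp _ _ = (- b) ^+ n *: ('X - b^-1%:P) ^+ n).
  by rewrite dvdpZr ?expf_neq0 ?oppr_eq0.
apply: poly_eq_off0 => x x0; rewrite horner_revp ?size_exp_XsubC //.
rewrite hornerZ !horner_exp !hornerXsubC -!exprMn; congr (_ ^+ _).
by field; rewrite b0 x0.
Qed.

(** In characteristic zero, differentiation lowers the multiplicity of a root by exactly one,
    because the factor [j.+1] is invertible. *)
Lemma dvdp_XsubC_exp_of_deriv p a n :
  p.[a] = 0 -> ('X - a%:P) ^+ n %| p^`() -> ('X - a%:P) ^+ n.+1 %| p.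
Proof.
move=> pa dvd; have [->|p0] := eqVneq p 0; first exact: dvdp0.
have [j [q]] := multiplicity_XsubC p a; rewrite p0 /= => qa pE.
case: j pE => [|j] pE.
  by move: pa; rewrite pE expr0 mulr1 => /eqP; rewrite -rootE (negPf qa).
suff lt_nj : (n < j.+1)%N by rewrite pE dvdp_mull // dvdp_exp2l.
rewrite ltnNge; apply/negP=> le_jn; move: dvd.
move/(dvdp_trans (dvdp_exp2l _ le_jn)).
rewrite pE derivM deriv_exp derivXsubC mul1r /= dvdp_addr ?dvdp_mulIr //.
have -> : q * (('X - a%:P) ^+ j *+ j.+1) =
    (q * j.+1%:R%:P) * ('X - a%:P) ^+ j by rewrite polyC_natr -mulr_natr; ring.
rewrite exprS dvdp_mul2r ?expf_neq0 ?polyXsubC_eq0 // dvdp_XsubCl rootM.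
by rewrite (negPf qa) rootC (negPf (natrS_neq0 _)).
Qed.

Lemma dvdp_XsubC_expP p a n :
  ('X - a%:P) ^+ n %| p <-> forall s, (s < n)%N -> p^`(s).[a] = 0.
Proof.
elim: n p => [|n IHn] p; first by split=> // _; rewrite dvd1p.
split=> [dvd [|s] lt_sn|ders].
- exact: horner_dvdp_XsubC_exp dvd.
- by rewrite derivSn; move: s lt_sn; apply/IHn/dvdp_deriv_XsubC_exp.
- apply: dvdp_XsubC_exp_of_deriv; first exact: (ders 0).
  by apply/IHn=> s lt_sn; rewrite -derivSn ders.
Qed.

(** The Taylor polynomial at [a], written as a polynomial in X composed with X - a. *)
Lemma exists_poly_jet a (w : nat -> F) n :
  exists p, forall s, (s < n)%N -> p^`(s).[a] = w s.
Proof.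
pose q := \poly_(i < n) (w i / i`!%:R); exists (q \Po ('X - a%:P)) => s lt_sn.
have derE : (q \Po ('X - a%:P))^`(s) = q^`(s) \Po ('X - a%:P).
  elim: {lt_sn} s => // s IHs.
  by rewrite !derivnS IHs deriv_comp derivXsubC mulr1.
rewrite derE horner_comp hornerXsubC subrr horner_coef0 coef_derivn addn0.
rewrite coef_poly lt_sn ffactnn -(mulr_natr (_ / _)) divfK //.
by have := fact_gt0 s; case: s`! => // k _; exact: natrS_neq0.
Qed.

Lemma derivnM_leibniz p q n :
  (p * q)^`(n) = \sum_(i < n.+1) (p^`(i) * q^`(n - i)) *+ 'C(n, i).
Proof.
elim: n => [|n IHn]; first by rewrite big_ord_recl big_ord0 addr0.
rewrite derivnS IHn raddf_sum /=.
under eq_bigr do rewrite derivMn derivM -!derivnS mulrnDl.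
rewrite big_split /= [RHS]big_ord_recl [in X in _ = X + _]bin0.
under [in RHS]eq_bigr do rewrite lift0 subSS binS mulrnDr.
rewrite big_split /= addrA addrC; congr (_ + _).
rewrite [in RHS]big_ord_recr /= bin_small // mulr0n addr0.
rewrite [in LHS]big_ord_recl bin0 subn0; congr (_ + _).
by apply: eq_bigr => i _; rewrite lift0 -!derivnS -subSn ?ltn_ord // subSS.
Qed.

(* The hypotheses say that V has the jet of z^(-e/2) at y^2. They amount to
   2 z V' = - e V up to order n - 1, whence (V^2 z^e)' vanishes to that order. *)
Lemma sqr_jet_sqrt_inv (V : {poly F}) (e : bool) (y : F) n : y != 0 ->
  (0 < n)%N -> V.[y ^+ 2] = y ^- e ->
  (forall s, (s.+1 < n)%N -> 2%:R * y ^+ 2 * V^`(s.+1).[y ^+ 2] =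
     - (e%:R + s.*2%:R) * V^`(s).[y ^+ 2]) ->
  ('X - (y ^+ 2)%:P) ^+ n %| V ^+ 2 * 'X ^+ e - 1.
Proof.
case: n => // n y0 _ V0 VS; set a := y ^+ 2 in V0 VS *.
have a0 : a != 0 by rewrite expf_neq0.
have ode : ('X - a%:P) ^+ n %| V^`() * 'X *+ 2 + V *+ e.
  apply/dvdp_XsubC_expP=> s lt_sn; rewrite derivnD !derivnMn.
  have dX i : (V^`() * 'X)^`(i.+1) = V^`()^`(i) *+ i.+1 + V^`()^`(i.+1) * 'X.
    by rewrite -(derivnMXaddC i _ 0) addr0.
  case: s lt_sn => [|s] lt_sn.
    rewrite !derivn0 hornerD !hornerMn hornerM hornerX.
    have := VS 0 lt_sn; rewrite derivn1 derivn0 addr0 => vs.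
    have -> : V^`().[a] * a *+ 2 = 2%:R * a * V^`().[a] by ring.
    by rewrite vs; ring.
  rewrite dX !(hornerD, hornerMn, hornerM, hornerX) -!derivSn.
  have vs := VS s.+1 lt_sn.
  have -> : (V^`(s.+1).[a] *+ s.+1 + V^`(s.+2).[a] * a) *+ 2 =
     2%:R * V^`(s.+1).[a] *+ s.+1 + 2%:R * a * V^`(s.+2).[a] by ring.
  by rewrite vs -muln2 natrM; ring.
apply: dvdp_XsubC_exp_of_deriv.
  rewrite hornerD hornerN hornerM !horner_exp hornerX V0 hornerC.
  by rewrite -exprVn /a -!exprM mulnC -exprMn mulVf // expr1n subrr.
(* For [e] true the derivative is [V] times the expression in [ode]. For [e] false the factor X in
   [ode] is a unit at the nonzero point [a] and is cancelled first. *)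
rewrite derivB derivC subr0; case: e V0 VS ode => /= _ _ ode.
  rewrite expr1 derivM derivX deriv_exp /= expr1.
  have -> : V^`() * V *+ 2 * 'X + V ^+ 2 * 1 = V * (V^`() * 'X *+ 2 + V *+ 1) by ring.
  by rewrite dvdp_mull.
rewrite expr0 mulr1 deriv_exp expr1.
move: ode; rewrite mulr0n addr0 -mulrnAl mulrC.
rewrite Gauss_dvdpr ?coprimep_XsubC_expr ?hornerX // => ode.
by rewrite -mulrnAl dvdp_mulr.
Qed.

End CharacteristicZero.
End PolyInterpolation.

(** * Jets of rational functions and palindromic interpolation *)

Section Jets.
Variable F : fieldType.
Implicit Types (p q T V Q H : {poly F}) (a b x y : F).

Definition ratderiv (r : {poly F} * {poly F}) :=
  (r.1^`() * r.2 - r.1 * r.2^`(), r.2 * r.2).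

(** A polynomial congruent to a fraction near [a] shares its derivatives there. By the quotient rule
    the error [T * r.2 - r.1] passes to its derivative times [r.2], minus itself times the
    derivative of [r.2], which costs one order per step. *)
Lemma iter_ratderiv_jet (r : {poly F} * {poly F}) T a n s :
  r.2.[a] != 0 -> ('X - a%:P) ^+ n %| T * r.2 - r.1 -> (s < n)%N ->
  (iter s ratderiv r).1.[a] / (iter s ratderiv r).2.[a] = T^`(s).[a].
Proof.
elim: s r T n => [|s IHs] r T [|n] // ra dvd lt_sn.
  have /eqP := horner_dvdp_XsubC_exp (ltn0Sn n) dvd; rewrite hornerD hornerN hornerM subr_eq0 => /eqP <-.
  by rewrite mulfK.
rewrite iterSr derivSn; apply: IHs lt_sn => [|/=].
  by rewrite hornerM mulf_neq0.
have -> : T^`() * (r.2 * r.2) - (r.1^`() * r.2 - r.1 * r.2^`()) =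
    (T * r.2 - r.1)^`() * r.2 - (T * r.2 - r.1) * r.2^`().
  by rewrite derivB derivM; ring.
rewrite dvdp_sub // dvdp_mulr ?dvdp_deriv_XsubC_exp //.
by apply: dvdp_trans dvd; rewrite dvdp_exp2l.
Qed.

Lemma exists_local_quotient p q a n :
  q.[a] != 0 -> exists T, ('X - a%:P) ^+ n %| T * q - p.
Proof.
move=> qa; have := coprimep_XsubC_expr n qa.
case/Bezout_eq1_coprimepP=> -[u v] /= uv; exists (v * p).
rewrite (_ : v * p * q - p = - (u * p) * ('X - a%:P) ^+ n) ?dvdp_mulIr //.
have -> : v * p * q = (1 - u * ('X - a%:P) ^+ n) * p by rewrite -uv; ring.
by ring.
Qed.

Hypothesis F0 : [pchar F] =i pred0.

(** A common nonzero value selects the sign of the square root: [p + q] is [2 v] at [a], hence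
    coprime to X - a. *)
Lemma dvdp_sub_of_sqr p q a v n : v != 0 -> p.[a] = v -> q.[a] = v ->
  ('X - a%:P) ^+ n %| p ^+ 2 - q ^+ 2 -> ('X - a%:P) ^+ n %| p - q.
Proof.
move=> v0 pa qa; rewrite subr_sqr Gauss_dvdpl // coprimep_XsubC_expr //.
by rewrite hornerD pa qa -mulr2n -mulr_natl mulf_neq0 ?natrS_neq0.
Qed.

(** The residue prescribed for the numerator of c: [V] stands for z^p, [T] for G, and the last
    factor clears the denominator z^l with l = L - 1. *)
Definition jet_target V T l := 2%:R * V * T * 'X^l.

(** Multiply by the unit X^e: since V^2 X^e is congruent to 1 and T Q to X^h, the square becomes 4
    X^(2h + 2l), and 2h = N + e. *)
Lemma jet_target_sqr V T Q (e : bool) h N l y n :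
  y != 0 -> (N + e = h.*2)%N ->
  ('X - (y ^+ 2)%:P) ^+ n %| V ^+ 2 * 'X ^+ e - 1 ->
  ('X - (y ^+ 2)%:P) ^+ n %| T * Q - 'X^h ->
  ('X - (y ^+ 2)%:P) ^+ n %|
    (jet_target V T l * Q) ^+ 2 - 4%:R * 'X ^+ (N + l.*2).
Proof.
move=> y0 Ne dV dT.
have cop : coprimep (('X - (y ^+ 2)%:P) ^+ n) 'X^e.
  by rewrite coprimep_expr // coprimep_XsubC_expr // hornerX expf_neq0.
rewrite -(Gauss_dvdpr _ cop).
have -> : 'X^e * ((jet_target V T l * Q) ^+ 2 - 4%:R * 'X ^+ (N + l.*2)) =
   4%:R * 'X^l ^+ 2 * ((V ^+ 2 * 'X ^+ e - 1) * (T * Q) ^+ 2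
       + (T * Q - 'X^h) * (T * Q + 'X^h)).
  have XE : 'X^e * 'X ^+ (N + l.*2) = 'X^l ^+ 2 * 'X^h ^+ 2 :> {poly F}.
    by rewrite -!exprM -!exprD; congr ('X ^+ _); lia.
  rewrite mulrBr [in X in _ - X]mulrCA XE /jet_target; ring.
by rewrite dvdp_mull // dvdp_add // dvdp_mulr.
Qed.

Lemma jet_target_val V T Q (e : bool) h N l y n :
  y != 0 -> (N + e = h.*2)%N -> (0 < n)%N -> V.[y ^+ 2] = y ^- e ->
  ('X - (y ^+ 2)%:P) ^+ n %| T * Q - 'X^h ->
  (jet_target V T l * Q).[y ^+ 2] = 2%:R * y ^+ (N + l.*2).
Proof.
move=> y0 Ne n_gt0 Va /(horner_dvdp_XsubC_exp n_gt0); rewrite hornerD hornerN hornerM hornerXn => /subr0_eq TQ.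
rewrite /jet_target !hornerM hornerXn Va -polyC_natr hornerC.
rewrite -[_ * _ * Q.[_]]mulrA [_ * Q.[_]]mulrC -!mulrA [T.[_] * _]mulrA TQ.
congr (_ * _); rewrite -!exprM -exprD -[RHS](mulKf (expf_neq0 e y0)) -exprD.
by congr (_ * _ ^+ _); lia.
Qed.

(** * Interpolation at nodes closed under inversion *)

Section Palindromic.
Variables (I : eqType) (s : seq I) (opp : I -> I) (y : I -> F).
Variables (Q : {poly F}) (N l : nat) (H : I -> {poly F}).
(** The nodes are given through chosen square roots [y t], so that the half-integer power in [H_val]
    is meaningful for odd [N] as well. *)
Local Notation z t := (y t ^+ 2).
Local Notation m t := (count_mem t s).

Hypothesis count_opp : forall t, m (opp t) = m t.
Hypothesis y_neq0 : forall t, y t != 0.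
Hypothesis y_opp : forall t, y (opp t) = (y t)^-1.
Hypothesis z_inj : {in s &, injective (fun t => z t)}.
Hypothesis szQ : (size Q <= N.+1)%N.
Hypothesis revQ : revp N Q = Q.
Hypothesis Qz : {in s, forall t, Q.[z t] != 0}.
Hypothesis H_sqr : {in s, forall t,
  ('X - (z t)%:P) ^+ m t %| (H t * Q) ^+ 2 - 4%:R * 'X ^+ (N + l.*2)}.
Hypothesis H_val : {in s, forall t, (H t * Q).[z t] = 2%:R * y t ^+ (N + l.*2)}.

Let W := \prod_(t <- s) ('X - (z t)%:P).

Lemma coprime_nodes : {in undup s &, forall t u, t != u ->
  coprimep (('X - (z t)%:P) ^+ m t) (('X - (z u)%:P) ^+ m u)}.
Proof.
move=> t u; rewrite !mem_undup => ts us ne_tu.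
apply/coprimep_expl/coprimep_expr/coprimep_XsubC2.
by rewrite subr_eq0 eq_sym; apply: contra ne_tu => /eqP /z_inj->.
Qed.

Lemma dvdp_nodes p : {in s, forall t, ('X - (z t)%:P) ^+ m t %| p} -> W %| p.
Proof.
move=> dvd; rewrite /W -prodr_undup_exp_count.
apply: dvdp_prod_coprime (undup_uniq s) coprime_nodes _ => t.
by rewrite mem_undup; apply: dvd.
Qed.

Lemma nodes_dvdp t : t \in s -> ('X - (z t)%:P) ^+ m t %| W.
Proof.
rewrite -mem_undup /W -prodr_undup_exp_count => ts.
by rewrite (perm_big _ (perm_to_rem ts)) big_cons dvdp_mulIl.
Qed.

Lemma size_nodes : size W = (size s).+1.
Proof. by rewrite size_prod_XsubC. Qed.

Lemma exists_interpolant : exists2 p : {poly F}, (size p <= size s)%N &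
  {in s, forall t, ('X - (z t)%:P) ^+ m t %| p - H t}.
Proof.
have [p hp] := poly_chinese H (undup_uniq s) coprime_nodes.
have W0 : W != 0 by rewrite -size_poly_gt0 size_nodes.
exists (p %% W) => [|t ts]; first by rewrite -ltnS -size_nodes ltn_modp.
have -> : p %% W - H t = p - H t - p %/ W * W by rewrite {2}(divp_eq p W); ring.
by rewrite dvdp_sub ?hp ?mem_undup // dvdp_mull // nodes_dvdp.
Qed.

(* Both p and its reversal solve the same square-root congruence at each node,
   with the same value there. *)
Lemma dvdp_sub_revp p (d : bool) : (size p <= (l.*2 + d.*2).+1)%N ->
  {in s, forall t, ('X - (z t)%:P) ^+ m t %| p - 'X ^+ d * H t} ->
  W %| p - revp (l.*2 + d.*2) p.
Proof.
(* Multiplying the target by X^d multiplies its square by X^(2d), so [D] takes the place of [l.*2]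
   in both the congruence and the value. *)
move=> szp hp; set D := (l.*2 + d.*2)%N in szp *; apply: dvdp_nodes => t ts.
have m_gt0 u : u \in s -> (0 < m u)%N by rewrite -has_count has_pred1.
have p_sqr u : u \in s ->
    ('X - (z u)%:P) ^+ m u %| (p * Q) ^+ 2 - 4%:R * 'X ^+ (N + D).
  move=> us; have XE : 'X ^+ (N + D) = 'X ^+ d ^+ 2 * 'X ^+ (N + l.*2) :> {poly F}.
    by rewrite -!exprM -exprD; congr ('X ^+ _); rewrite /D; lia.
  have -> : (p * Q) ^+ 2 - 4%:R * 'X ^+ (N + D) =
     (p - 'X ^+ d * H u) * (p + 'X ^+ d * H u) * Q ^+ 2 +
     'X ^+ d ^+ 2 * ((H u * Q) ^+ 2 - 4%:R * 'X ^+ (N + l.*2)).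
    by rewrite XE; ring.
  apply: dvdp_add; first by rewrite -mulrA dvdp_mulr ?hp.
  by rewrite dvdp_mull ?H_sqr.
have p_val u : u \in s -> (p * Q).[z u] = 2%:R * y u ^+ (N + D).
  move=> us; have := horner_dvdp_XsubC_exp (m_gt0 u us) (hp u us); rewrite hornerD hornerN => /subr0_eq pE.
  rewrite hornerM pE hornerM hornerXn -mulrA -hornerM H_val //.
  rewrite mulrCA -exprM -exprD; congr (_ * _ ^+ _); rewrite /D; lia.
have os : opp t \in s by rewrite -has_pred1 has_count count_opp m_gt0.
have zt0 u : z u != 0 by rewrite expf_neq0.
have zoK : (z (opp t))^-1 = z t by rewrite y_opp exprVn invrK.
have szpQ : (size (p * Q)%R <= (D + N).+1)%N.
  by apply: leq_trans (size_polyMleq _ _) _; lia.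
have sz2 : (size ((p * Q) ^+ 2 - 4%:R * 'X ^+ (N + D))%R <= (D + N).*2.+1)%N.
  rewrite -polyC_natr mul_polyC (leq_trans (size_polyD _ _)) // geq_max.
  rewrite size_polyN expr2; apply/andP; split.
    by apply: leq_trans (size_polyMleq _ _) _; move: szpQ; set k := size _; lia.
  by rewrite (leq_trans (size_scale_leq _ _)) // size_polyXn; lia.
(* The congruence at [opp t] is reversed in degree 2 (D + N): X^(N + D) is the middle monomial and
   stays fixed, [Q] is palindromic, and the node moves to its inverse [z t]. *)
have r_sqr : ('X - (z t)%:P) ^+ m t %|
    (revp D p * Q) ^+ 2 - 4%:R * 'X ^+ (N + D).
  have := p_sqr _ os; rewrite count_opp => /(dvdp_revp F0 (zt0 _) sz2).
  rewrite zoK; congr (_ %| _); apply: (poly_eq_off0 F0) => x x0.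
  rewrite horner_revp // -[in RHS]revQ -polyC_natr.
  rewrite !(hornerD, hornerN, horner_exp, hornerM) !horner_revp //.
  rewrite !hornerC !hornerX exprVn -addnn exprD [(N + D)%N]addnC.
  by rewrite exprD; field; rewrite !expf_neq0.
have r_val : (revp D p * Q).[z t] = 2%:R * y t ^+ (N + D).
  rewrite -{1}revQ hornerM !horner_revp // mulrACA -hornerM -exprVn -y_opp p_val //.
  rewrite y_opp -exprD mulrCA -exprM exprVn; congr (_ * _).
  by rewrite [(D + N)%N]addnC mulnC exprM mulfK ?expf_neq0.
rewrite -(Gauss_dvdpl _ (coprimep_XsubC_expr _ (Qz ts))) mulrBl.
apply: (dvdp_sub_of_sqr (v := 2%:R * y t ^+ (N + D))) => //; last 1 first.
- have := dvdp_sub (p_sqr t ts) r_sqr.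
  by congr (_ %| _); ring.
- by rewrite mulf_neq0 ?natrS_neq0 // expf_neq0.
- exact: p_val.
Qed.

Lemma exists_palindromic_interpolant :
  size s = l.*2.+1 \/ size s = l.*2.+2 /\ \prod_(t <- s) z t = 1 ->
  exists2 p : {poly F}, (size p <= l.*2.+1)%N /\ revp l.*2 p = p &
    {in s, forall t, ('X - (z t)%:P) ^+ m t %| p - H t}.
Proof.
have [p szp hp] := exists_interpolant.
case=> [sz_s|[sz_s prod_z]].
  exists p => //; split; first by rewrite -sz_s.
  apply/eqP; rewrite eq_sym -subr_eq0.
  apply: contraT => nz.
  have szp0 : (size p <= (l.*2 + false.*2).+1)%N by rewrite addn0 -sz_s.
  have := dvdp_sub_revp szp0; rewrite addn0 => W_dvd.
  have /W_dvd/(dvdp_leq nz) :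
      {in s, forall t, ('X - (z t)%:P) ^+ m t %| p - 'X^false * H t}.
    by move=> t ts; rewrite mul1r hp.
  rewrite size_nodes leqNgt ltnS (leq_trans (size_polyD _ _)) // geq_max szp.
  by rewrite size_polyN sz_s size_revp.
(* Now [p] may have degree 2l + 1, one too many for a numerator. X p is reversed in degree 2l + 2,
   the degree of [W], so the difference can only be a scalar multiple of [W]. *)
have szXp : (size ('X * p)%R <= (l.*2 + true.*2).+1)%N.
  by rewrite mulrC (leq_trans (size_polyMleq _ _)) // size_polyX; lia.
have /(dvdp_sub_revp szXp) : {in s, forall t,
    ('X - (z t)%:P) ^+ m t %| 'X * p - 'X^true * H t}.
  by move=> t ts; rewrite -mulrBr dvdp_mull ?hp.
rewrite addn2; set E := revp _ _ => W_dvd.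
have szd : (size ('X * p - E)%R <= size W)%N.
  rewrite size_nodes sz_s (leq_trans (size_polyD _ _)) // geq_max size_polyN.
  by rewrite size_revp -[l.*2.+2]addn2 szXp.
have [a dE] : exists a : F, 'X * p - E = a *: W.
  case/dvdpP: W_dvd => q qE.
  have [q0|q0] := eqVneq q 0; first by exists 0; rewrite qE q0 mul0r scale0r.
  have : (size q <= 1)%N.
    move: szd; rewrite qE size_Mmonic ?monic_prod_XsubC // size_nodes.
    by lia.
  by move/size1_polyC=> qC; exists q`_0; rewrite qE qC mul_polyC coefC.
have WM : W`_(l.*2.+2) = 1.
  have /monicP := monic_prod_XsubC s xpredT (fun t => z t).
  by rewrite lead_coefE -/W size_nodes sz_s.
have W0 : W`_0 = 1.
  rewrite -horner_coef0 horner_prod.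
  under eq_bigr do rewrite hornerXsubC sub0r -mulN1r.
  rewrite big_split /= prod_z mulr1 big_const_seq iter_mulr_1 count_predT sz_s.
  by rewrite -signr_odd /= negbK odd_double.
(* As X p has no constant term, the top coefficient of the difference is the coefficient of p at 2l
   + 1 and the constant one is its opposite. [W] has 1 at both ends, so a = -a. *)
have a0 : a = 0.
  have := congr1 (fun q : {poly F} => q`_0) dE.
  have := congr1 (fun q : {poly F} => q`_(l.*2.+2)) dE.
  rewrite /= !coefZ W0 WM !mulr1 !coefB !coefXM /E !coef_poly !ltnS leqnn /=.
  rewrite subn0 subnn !coefXM /= subr0 sub0r => -> /eqP.
  rewrite eq_sym -subr_eq0 opprK -mulr2n -mulr_natl mulf_eq0 (negPf (natrS_neq0 F0 1)).
  by move/eqP.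
have XpE : 'X * p = E by apply/subr0_eq; rewrite dE a0 scale0r.
(* The top coefficient of X p equals its constant one, which is zero: the surplus degree
   disappears. *)
have szp' : (size p <= l.*2.+1)%N.
  apply/leq_sizeP=> j; rewrite leq_eqVlt => /predU1P[<-|lt_j].
    have := congr1 (fun q : {poly F} => q`_(l.*2.+2)) XpE.
    by rewrite /= coefXM /= => ->; rewrite coef_poly leqnn subnn coefXM.
  by apply: (leq_sizeP _ _ szp); rewrite sz_s.
exists p => //; split=> //; apply/polyP=> i; rewrite coef_poly ltnS.
case: leqP => [le_i|lt_i]; last by rewrite (leq_sizeP _ _ szp').
have := congr1 (fun q : {poly F} => q`_i.+1) XpE.
rewrite /= coefXM /= => ->; rewrite coef_poly ltnS ltnS ltnW //.
by rewrite subSS subSn // coefXM.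
Qed.

End Palindromic.
End Jets.

(** * Cplx as a field *)

(* Cplx is convertible to R * R, which already carries the product ring
   structure; the alias CC receives the field structure. *)
Definition CC : Type := Cplx.

HB.instance Definition _ := Choice.copy CC (R * R)%type.
HB.instance Definition _ := GRing.isZmodule.Build CC
  Cadd_assoc Cadd_comm Cadd_0l Cadd_opp_l.

Fact CC_mul_1l : left_id (C1 : CC) Cmul. Proof. exact: Cmul_1l. Qed.
Fact CC_mul_addl : left_distributive (Cmul : CC -> CC -> CC) +%R.
Proof. exact: Cmul_add_l. Qed.
Fact CC_one_neq0 : (C1 : CC) != 0. Proof. by apply/eqP; exact: C1_neq_C0. Qed.

HB.instance Definition _ := GRing.Zmodule_isComNzRing.Build CC
  Cmul_assoc Cmul_comm CC_mul_1l CC_mul_addl CC_one_neq0.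

Fact CC_mulVf (a : CC) : a != 0 -> Cmul (Cinv a) a = 1 :> CC.
Proof. by move=> /eqP; exact: Cinv_l. Qed.

HB.instance Definition _ := GRing.ComNzRing_isField.Build CC CC_mulVf Cinv_C0.

Lemma natr_CC n : n%:R = RtoC (INR n) :> CC.
Proof. by elim: n => // n IHn; rewrite mulrSr IHn S_INR RtoC_add. Qed.

Lemma pchar_CC : [pchar CC] =i pred0.
Proof.
apply/pcharf0P=> n; rewrite natr_CC; case: n => [|n]; first exact: eqxx.
by apply/eqP=> /(congr1 (@fst R R)) e; apply: (not_0_INR n.+1 _ e).
Qed.

Lemma binomial_CC s i : (i <= s)%N -> RtoC (Binomial.C s i) = ('C(s, i)%:R : CC).
Proof.
have factE n : fact n = n`! by elim: n => //= n ->; rewrite factS; lia.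
move=> le_is; rewrite natr_CC; congr RtoC; apply: binomial_INR.
by rewrite !factE -(bin_fact le_is).
Qed.

Lemma count_occ_CC (x : CC) (l : seq CC) : mult x l = count_mem x l.
Proof.
elim: l => //= a l IHl; rewrite -IHl /mult /=.
by case: Ceq_dec => [->|/eqP/negPf->]; rewrite ?eqxx.
Qed.

Lemma perm_CC (l1 l2 : seq CC) : Permutation l1 l2 -> perm_eq l1 l2.
Proof.
elim=> //= [x l l' _ IH|x y l|l l' l'' _ IH1 _]; last exact: perm_trans.
- by rewrite perm_cons.
- by rewrite -cat1s -[x :: l]cat1s -[x :: y :: l]cat1s -[y :: l]cat1s perm_catCA.
Qed.

Lemma mem_In_CC (x : CC) (l : seq CC) : x \in l -> In x l.
Proof.
elim: l => //= a l IHl; rewrite inE => /predU1P[->|/IHl]; first by left.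
by right.
Qed.

(** * Coefficient lists and formal fractions as MathComp polynomials *)

Definition poly_of_list (l : list Cplx) : {poly CC} := Poly (l : seq CC).

Lemma poly_of_list_padd p q : poly_of_list (padd p q) = poly_of_list p + poly_of_list q.
Proof.
rewrite /poly_of_list; elim: p q => [|a p IHp] [|b q] /=; rewrite ?add0r ?addr0 //.
by rewrite !cons_poly_def IHp (polyCD (a : CC)); ring.
Qed.

Lemma poly_of_list_pscale (c : CC) p : poly_of_list (pscale c p) = c *: poly_of_list p.
Proof.
rewrite /poly_of_list; elim: p => [|a p IHp] /=; first by rewrite scaler0.
by rewrite !cons_poly_def IHp (polyCM (c : CC)) scalerDr -!mul_polyC mulrA.
Qed.

Lemma poly_of_list_popp p : poly_of_list (popp p) = - poly_of_list p.
Proof.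
rewrite /poly_of_list; elim: p => [|a p IHp] /=; first by rewrite oppr0.
by rewrite !cons_poly_def IHp (polyCN (a : CC)); ring.
Qed.

Lemma poly_of_list_pmul p q : poly_of_list (pmul p q) = poly_of_list p * poly_of_list q.
Proof.
elim: p => [|a p IHp]; first by rewrite /poly_of_list mul0r.
rewrite /= poly_of_list_padd poly_of_list_pscale {2}/poly_of_list /= -/(poly_of_list _) IHp.
by rewrite /poly_of_list /= !cons_poly_def -mul_polyC addr0; ring.
Qed.

Lemma poly_of_list_pderiv p : poly_of_list (pderiv p) = (poly_of_list p)^`().
Proof.
case: p => [|a p]; rewrite /poly_of_list /= ?deriv0 // cons_poly_def derivMXaddC.
(* For n at least 1, [pderiv_aux n] computes the derivative of X^n p divided by X^(n-1); the
   generalisation over [n] carries the induction. *)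
suff aux n : Poly (pderiv_aux n p : seq CC) =
    n%:R * Poly (p : seq CC) + (Poly (p : seq CC))^`() * 'X.
  by rewrite aux mul1r.
elim: p n => [|b p IHp] n /=; first by rewrite deriv0 mulr0 mul0r addr0.
rewrite !cons_poly_def IHp derivMXaddC -natr_CC (polyCM (n%:R : CC)) polyC_natr.
by rewrite -natr1; ring.
Qed.

Lemma peval_CC p (z : CC) : peval p z = (poly_of_list p).[z].
Proof.
rewrite /poly_of_list; elim: p => [|a p IHp] /=; first by rewrite horner0.
by rewrite cons_poly_def hornerMXaddC -IHp addrC mulrC.
Qed.

Lemma poly_of_list_monomial n : poly_of_list (monomial n) = 'X^n.
Proof.
rewrite /poly_of_list /monomial; elim: n => [|n IHn] /=.
  by rewrite cons_poly_def mul0r add0r.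
by rewrite cons_poly_def IHn addr0 exprSr.
Qed.

Definition polys_of_rat (r : Defs.rat) := (poly_of_list (fst r), poly_of_list (snd r)).

Lemma polys_of_rat_rderiv_n s r : polys_of_rat (rderiv_n s r) = iter s (@ratderiv CC) (polys_of_rat r).
Proof.
elim: s => //= s <-; rewrite /polys_of_rat /ratderiv /= /psub poly_of_list_padd.
by rewrite poly_of_list_popp !poly_of_list_pmul !poly_of_list_pderiv.
Qed.

Lemma reval_CC r (z : CC) : reval r z = (polys_of_rat r).1.[z] / (polys_of_rat r).2.[z].
Proof. by rewrite /reval !peval_CC. Qed.

Lemma Csum_upto_CC n (f : nat -> CC) : Csum_upto n f = \sum_(i < n.+1) f i.
Proof.
rewrite -(big_mkord xpredT f) /index_iota subn0 /Csum_upto.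
have -> : List.seq 0 n.+1 = iota 0 n.+1.
  by move: (n.+1) 0%N; elim=> //= k IHk j; rewrite IHk.
by elim: (iota _ _) => [|i l IHl]; rewrite ?big_nil // big_cons /= IHl.
Qed.

(** * The interpolation problem of the pseudo-splines *)

Lemma ceil_half_double n : (n + ~~ Nat.even n = (ceil_half n).*2)%N.
Proof. by have := ceil_half_spec n; case: Nat.even => /=; lia. Qed.

Section Nodes.
Variable k : nat.
Implicit Types x : CC.

Definition sqrt_node x : CC := ex k.+2 (Copp x).

Lemma sqrt_node_neq0 x : sqrt_node x != 0.
Proof. by apply/eqP; exact: ex_neq_C0. Qed.

Lemma sqrt_node_opp x : sqrt_node (Copp x) = (sqrt_node x)^-1.
Proof.
apply: (mulIf (sqrt_node_neq0 x)); rewrite mulVf ?sqrt_node_neq0 //.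
exact: ex_opp_mul.
Qed.

Lemma sqrt_node_sqr x : sqrt_node x ^+ 2 = ex k.+1 (Copp x) :> CC.
Proof. exact: ex_succ_sqr. Qed.

Lemma node_inj (l : seq CC) : in_strip l ->
  {in l &, injective (fun x => sqrt_node x ^+ 2)}.
Proof.
move=> strip x u /mem_In_CC xl /mem_In_CC ul; rewrite !sqrt_node_sqr => e.
exact: in_strip_node_inj strip xl ul e.
Qed.

(** The exponents sum to their own opposite, hence to 0. This makes [Q] palindromic and gives the
    node polynomial constant term 1 for even M. *)
Lemma prod_ex_eq1 j (l : seq CC) : perm_eq (map (Copp : CC -> CC) l) l ->
  \prod_(x <- l) (ex j x : CC) = 1.
Proof.
move=> l_opp; have ex1 : ex j (0 : CC) = 1 :> CC by exact: ex_C0.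
rewrite -(big_morph (ex j : CC -> CC) (ex_add j) ex1) -ex1; congr (ex j _).
set sum := \sum_(x <- l) x.
have sum_opp : sum = - sum by rewrite {1}/sum -(perm_big _ l_opp) big_map sumrN.
apply/eqP; rewrite -[_ == _](orb_idl (a := 2%:R == 0 :> CC)).
  by rewrite -mulf_eq0 mulr_natl mulr2n {1}sum_opp addNr.
by rewrite (negPf (natrS_neq0 pchar_CC 1)).
Qed.

Definition is_power_jet N x n (V : {poly CC}) :=
  forall i, (i < n)%N -> V^`(i).[sqrt_node x ^+ 2] = power_jet k N x i.

Lemma power_jet_val N x n V : (0 < n)%N -> is_power_jet N x n V ->
  V.[sqrt_node x ^+ 2] = sqrt_node x ^- (~~ Nat.even N).
Proof.
move=> n0 /(_ _ n0); rewrite derivn0 power_jet_0 => ->.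
by case: Nat.even; rewrite /= ?expr0 ?invr1 ?expr1.
Qed.

Lemma power_jet_sqr N x n V : (0 < n)%N -> is_power_jet N x n V ->
  ('X - (sqrt_node x ^+ 2)%:P) ^+ n %| V ^+ 2 * 'X ^+ (~~ Nat.even N) - 1.
Proof.
move=> n0 Vx; apply: (sqr_jet_sqrt_inv pchar_CC) => //.
- exact: sqrt_node_neq0.
- exact: power_jet_val Vx.
move=> s lt_sn; rewrite !Vx // 1?ltnW // sqrt_node_sqr natr_CC.
apply: etrans (power_jet_succ k N x s) _; rewrite two_p_par.
rewrite -natrD natr_CC -[RHS]/(Cmul (Copp _) _); congr Cmul.
rewrite (_ : (_ + s.*2)%N = Nat.add (if Nat.even N then 0%N else 1%N) (Nat.mul 2 s)).
  by rewrite /RtoC /Copp /=; congr pair; apply/esym/Ropp_0.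
by case: Nat.even => /=; lia.
Qed.

Variables (Gam : seq CC) (th : CC).

Let K : CC := Kconst k Gam th.
Let Q := (polys_of_rat (Ginv_rat k Gam th)).2.
Let N := size Gam.

Lemma Ginv_num : (polys_of_rat (Ginv_rat k Gam th)).1 = 'X^(ceil_half N).
Proof. exact: poly_of_list_monomial. Qed.

Lemma Ginv_denE : Q = K *: \prod_(x <- Gam) ((ex k.+1 x : CC) *: 'X + 1).
Proof.
rewrite /Q /= poly_of_list_pscale -/K; congr (_ *: _).
elim: Gam => [|x l IHl]; first by rewrite big_nil /poly_of_list /= cons_poly_def mul0r add0r.
rewrite big_cons -IHl; apply: etrans (poly_of_list_pmul _ _) _; congr (_ * _).
by rewrite /poly_of_list /= !cons_poly_def mul0r add0r mul_polyC.
Qed.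

Lemma horner_Ginv_den z :
  Q.[z] = K * \prod_(x <- Gam) ((ex k.+1 x : CC) * z + 1).
Proof.
rewrite Ginv_denE hornerZ horner_prod; congr (_ * _).
by apply: eq_bigr => x _; rewrite hornerD hornerZ hornerX hornerC.
Qed.

Lemma size_Ginv_den : (size Q <= N.+1)%N.
Proof.
rewrite Ginv_denE (leq_trans (size_scale_leq _ _)) // /N.
elim: Gam => [|x l IHl]; first by rewrite big_nil size_poly1.
rewrite big_cons (leq_trans (size_polyMleq _ _)) //=.
have : (size ((ex k.+1 x : CC) *: 'X + 1)%R <= 2)%N.
  rewrite (leq_trans (size_polyD _ _)) // geq_max size_poly1 andbT.
  by rewrite (leq_trans (size_scale_leq _ _)) // size_polyX.
by move: IHl; set a := size _; set b := size _; set c := size _; lia.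
Qed.

Hypothesis Gam_opp : perm_eq (map (Copp : CC -> CC) Gam) Gam.

(** Distributing z^N over the factors turns them into z + e_x = e_x (1 + z / e_x). The product of
    the e_x is 1, and negation of the exponents permutes the remaining factors. *)
Lemma revp_Ginv_den : revp N Q = Q.
Proof.
apply: (poly_eq_off0 pchar_CC) => z z0; rewrite horner_revp ?size_Ginv_den //.
rewrite !horner_Ginv_den mulrCA; congr (_ * _).
have -> : z ^+ N = \prod_(x <- Gam) z.
  by rewrite big_const_seq count_predT iter_mulr_1.
rewrite -[RHS](perm_big _ Gam_opp) big_map /=.
have := prod_ex_eq1 k.+1 Gam_opp; set e := \prod_(x <- Gam) _ => e1.
rewrite -[RHS]mul1r -[X in _ = X * _]e1 -!big_split /=.
apply: eq_bigr => x _; rewrite mulrDr mulrCA mulfV // mulr1 [RHS]mulrDr !mulr1.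
have -> : (ex k.+1 x : CC) * ((ex k.+1 (Copp x) : CC) * z) = z; last by rewrite addrC.
rewrite mulrA [_ * (ex k.+1 (Copp x) : CC)]mulrC.
by have -> : (ex k.+1 (Copp x) : CC) * (ex k.+1 x : CC) = 1; [exact: ex_opp_mul|rewrite mul1r].
Qed.

Hypothesis Gam_strip : in_strip Gam.
Hypothesis K_neq0 : K != 0.

Lemma Ginv_den_neq0 x : x \in Gam -> Q.[sqrt_node x ^+ 2] != 0.
Proof.
move=> /mem_In_CC xG; rewrite horner_Ginv_den mulf_neq0 //.
rewrite prodf_seq_neq0; apply/allP=> u /mem_In_CC uG; rewrite sqrt_node_sqr.
by apply/implyP=> _; apply/eqP; exact: in_strip_factor_neq_C0 Gam_strip xG uG.
Qed.

(** With polynomials [V], [T] and [S] standing for z^p, G and c near the node, the Leibniz rule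
    reads the prescribed sum as a derivative of [2 V T]. The condition is then a congruence between
    [S] and [2 V T], and multiplying by the unit X^(L-1) clears the denominator. *)
Lemma jet_condition (L : nat) (cf : Z -> Cplx) x n V T :
  is_power_jet N x n V -> x \in Gam ->
  ('X - (sqrt_node x ^+ 2)%:P) ^+ n %| T * Q - 'X^(ceil_half N) ->
  (forall s, (s < n)%N ->
     reval (rderiv_n s (laurent_rat L cf)) (ex k.+1 (Copp x)) =
     Csum_upto s (fun i =>
       Cmul (RtoC (Binomial.C s i))
         (Cmul (v_coef k N x i)
            (reval (rderiv_n (Nat.sub s i) (Ginv_rat k Gam th)) (ex k.+1 (Copp x))))))
  <-> ('X - (sqrt_node x ^+ 2)%:P) ^+ n %|
       (polys_of_rat (laurent_rat L cf)).1 - jet_target V T L.-1.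
Proof.
move=> Vx xG dT; set P := (polys_of_rat _).1; set a := sqrt_node x ^+ 2.
have a0 : a != 0 by rewrite expf_neq0 ?sqrt_node_neq0.
have denE : (polys_of_rat (laurent_rat L cf)).2 = 'X^(L.-1).
  by rewrite -subn1; exact: poly_of_list_monomial.
have XLa : ('X^(L.-1) : {poly CC}).[a] != 0 by rewrite hornerXn expf_neq0.
have [S dS] := exists_local_quotient P n XLa.
have lhsE s : (s < n)%N ->
    reval (rderiv_n s (laurent_rat L cf)) (ex k.+1 (Copp x)) = S^`(s).[a] :> CC.
  move=> lt_sn; rewrite reval_CC polys_of_rat_rderiv_n -sqrt_node_sqr.
  by apply: (@iter_ratderiv_jet _ _ S a n s _ _ lt_sn); rewrite denE.
have GE s : (s < n)%N ->
    reval (rderiv_n s (Ginv_rat k Gam th)) (ex k.+1 (Copp x)) = T^`(s).[a] :> CC.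
  move=> lt_sn; rewrite reval_CC polys_of_rat_rderiv_n -sqrt_node_sqr.
  apply: (@iter_ratderiv_jet _ _ T a n s _ _ lt_sn); rewrite ?Ginv_num //; exact: Ginv_den_neq0.
have rhsE s : (s < n)%N -> Csum_upto s (fun i =>
       Cmul (RtoC (Binomial.C s i))
         (Cmul (v_coef k N x i)
            (reval (rderiv_n (Nat.sub s i) (Ginv_rat k Gam th)) (ex k.+1 (Copp x)))))
    = (2%:R * V * T)^`(s).[a] :> CC.
  move=> lt_sn; rewrite Csum_upto_CC derivnM_leibniz horner_sum.
  apply: eq_bigr => i _; have le_is : (i <= s)%N by rewrite -ltnS.
  rewrite binomial_CC // v_coef_power_jet -(Vx i (leq_ltn_trans le_is lt_sn)).
  rewrite GE ?(leq_ltn_trans (leq_subr _ _)) // hornerMn hornerM.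
  have -> : (2%:R * V)^`(i).[a] = 2%:R * V^`(i).[a].
    by rewrite mulr_natl derivnMn hornerMn mulr_natl.
  by rewrite -[RHS]mulr_natl -[2%:R]/(1 + 1 : CC) -[RtoC 2]/(RtoC (INR 2)) -natr_CC.
have -> : jet_target V T L.-1 = 2%:R * V * T * 'X^(L.-1) by [].
have dE : P - 2%:R * V * T * 'X^(L.-1) =
    (S - 2%:R * V * T) * 'X^(L.-1) - (S * 'X^(L.-1) - P) by ring.
rewrite dE dvdp_subl // Gauss_dvdpl ?coprimep_XsubC_expr //.
rewrite (dvdp_XsubC_expP pchar_CC); split=> H s lt_sn; have := H s lt_sn.
  by rewrite lhsE // rhsE // derivnB hornerD hornerN => ->; rewrite subrr.
by rewrite lhsE // rhsE // derivnB hornerD hornerN => /subr0_eq.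
Qed.

End Nodes.

(** * Numerators of Laurent polynomials; existence and uniqueness *)

Lemma coef_laurent_num L cf i :
  (polys_of_rat (laurent_rat L cf)).1`_i =
  if (i < L.*2.-1)%N then cf (Z.sub (Z.of_nat i) (Z.sub (Z.of_nat L) (Zpos xH)))
  else 0 :> CC.
Proof.
rewrite /= /poly_of_list coef_Poly (_ : Nat.sub _ 1 = L.*2.-1)%N; last by lia.
have -> : List.seq 0 L.*2.-1 = iota 0 L.*2.-1.
  by move: L.*2.-1 0%N; elim=> //= m IHm j; rewrite IHm.
case: ltnP => [lt_i|le_i]; last by rewrite nth_default // size_map size_iota.
by rewrite (nth_map 0%N) ?size_iota // nth_iota.
Qed.

Lemma size_laurent_num L cf : (size (polys_of_rat (laurent_rat L cf)).1 <= L.*2.-1)%N.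
Proof. by apply/leq_sizeP=> i le_i; rewrite coef_laurent_num ltnNge le_i. Qed.

Lemma laurent_num_coef L (p : {poly CC}) : (size p <= L.*2.-1)%N ->
  (polys_of_rat (laurent_rat L (laurent_coef L (fun i => p`_i)))).1 = p.
Proof.
move=> szp; apply/polyP=> i; rewrite coef_laurent_num.
case: ltnP => [lt_i|le_i]; last by rewrite (leq_sizeP _ _ szp).
by rewrite laurent_coef_nth //; lia.
Qed.

Lemma reval_laurent_inv L cf (z : CC) :
  (0 < L)%N -> z != 0 -> revp L.-1.*2 (polys_of_rat (laurent_rat L cf)).1 =
                          (polys_of_rat (laurent_rat L cf)).1 ->
  reval (laurent_rat L cf) z = reval (laurent_rat L cf) (Cinv z).
Proof.
case: L => // L _ z0; rewrite !reval_CC.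
have -> : (polys_of_rat (laurent_rat L.+1 cf)).2 = 'X^L.
  by rewrite -[in RHS](succnK L) -subn1; exact: poly_of_list_monomial.
have := size_laurent_num L.+1 cf; rewrite doubleS /= -/(polys_of_rat _).
set p := (poly_of_list _) => szp pal; rewrite -{1}pal horner_revp // !hornerXn.
rewrite -[Cinv z]/(z^-1) -addnn exprD exprVn invrK.
by rewrite mulrAC mulfK ?expf_neq0 // mulrC.
Qed.

Lemma exists_unique_pseudospline k (Gam Gt : list Cplx) (th : Cplx) :
  symmetric_multiset Gam -> symmetric_multiset Gt -> sub_multiset Gt Gam ->
  Nat.even (length Gt) = Nat.even (length Gam) -> Kconst k Gam th <> C0 ->
  exists cf, pseudospline_conditions k Gam Gt th cf /\
    (forall cf', pseudospline_conditions k Gam Gt th cf' -> forall n, cf' n = cf n).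
Proof.
move=> symG symGt /sub_multiset_incl subG eq_even K0'.
have K0 : (Kconst k Gam th : CC) != 0 by exact/eqP.
have G_opp := perm_CC (symmetric_multiset_opp _ symG).
have Gt_opp := perm_CC (symmetric_multiset_opp _ symGt).
have G_strip := symmetric_multiset_in_strip _ symG.
have Gt_strip := symmetric_multiset_in_strip _ symGt.
set s : seq CC := Gt; set L := ceil_half (size s); set N := size (Gam : seq CC).
have in_G (x : CC) : x \in s -> x \in (Gam : seq CC).
  move=> /mem_In_CC/subG; elim: (Gam : seq CC) => //= a l IHl [->|/IHl xl].
    exact: mem_head.
  by rewrite inE xl orbT.
(* By the parity hypothesis this bit serves the cardinalities of both multisets. *)
set e := (~~ Nat.even N) : bool.
have sizeL : (size s + e = L.*2)%N by rewrite -ceil_half_double -[size s]/(length Gt) eq_even.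
have sizeN : (N + e = (ceil_half N).*2)%N by rewrite ceil_half_double.
set Q := (polys_of_rat (Ginv_rat k Gam th)).2.
pose y := sqrt_node k.
have y0 x : y x != 0 by exact: sqrt_node_neq0.
have z_inj := @node_inj k s Gt_strip.
have Qz (x : CC) : x \in s -> Q.[y x ^+ 2] != 0.
  by move=> /in_G; exact: Ginv_den_neq0.
(* Choice turns the local polynomials into functions of the exponent, as the target [H] must be one.
   Off [s] the second component is the dummy 0. *)
have /boolp.choice[VT hVT] (x : CC) : exists VT : {poly CC} * {poly CC},
    is_power_jet k N x (count_mem x s) VT.1 /\
    (x \in s -> ('X - (y x ^+ 2)%:P) ^+ count_mem x s %|
                   VT.2 * Q - 'X^(ceil_half N)).
  have [V hV] := exists_poly_jet pchar_CC (y x ^+ 2) (power_jet k N x) (count_mem x s).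
  have [/Qz Qx|xNs] := boolP (x \in s); last by exists (V, 0).
  have [T hT] := exists_local_quotient 'X^(ceil_half N) (count_mem x s) Qx.
  by exists (V, T).
pose H x := jet_target (VT x).1 (VT x).2 L.-1.
have cnt_gt0 (x : CC) : x \in s -> (0 < count_mem x s)%N.
  by rewrite -has_count has_pred1.
have condP cf :
    (forall vth i, lt i (mult vth Gt) ->
     reval (rderiv_n i (laurent_rat L cf)) (ex k.+1 (Copp vth)) =
     Csum_upto i (fun j => Cmul (RtoC (Binomial.C i j))
       (Cmul (v_coef k (length Gam) vth j)
         (reval (rderiv_n (Nat.sub i j) (Ginv_rat k Gam th)) (ex k.+1 (Copp vth))))))
    <-> {in s, forall x, ('X - (y x ^+ 2)%:P) ^+ count_mem x s %|
           (polys_of_rat (laurent_rat L cf)).1 - H x}.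
  split=> [hcf x xs|hcf x i /ltP].
    have [hV /(_ xs) hT] := hVT x.
    apply/(jet_condition G_strip K0 L cf hV (in_G x xs) hT) => i lt_i.
    by apply: hcf; apply/ltP; rewrite count_occ_CC.
  rewrite count_occ_CC => lt_i.
  have xs : x \in s by rewrite -has_pred1 has_count (leq_ltn_trans _ lt_i).
  have [hV /(_ xs) hT] := hVT x.
  exact: (jet_condition G_strip K0 L cf hV (in_G x xs) hT).2 (hcf x xs) i lt_i.
have uniq cf cf' : pseudospline_conditions k Gam Gt th cf ->
    pseudospline_conditions k Gam Gt th cf' -> forall n, cf' n = cf n.
  move=> [_ [out /condP hcf]] [_ [out' /condP hcf']].
  apply: (laurent_support_ext L) => // i lt_i.
  suff eqP : (polys_of_rat (laurent_rat L cf')).1 = (polys_of_rat (laurent_rat L cf)).1.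
    have lt_i' : (i < L.*2.-1)%N by lia.
    by have := coef_laurent_num L cf' i; rewrite eqP coef_laurent_num lt_i'.
  apply/eqP; rewrite -subr_eq0; apply: contraT => nz.
  (* The difference of the numerators has at most 2L - 1 coefficients, hence at most M, while a
     nonzero multiple of the node polynomial has at least M + 1. *)
  have /(dvdp_leq nz) : \prod_(x <- s) ('X - (y x ^+ 2)%:P) %|
      (polys_of_rat (laurent_rat L cf')).1 - (polys_of_rat (laurent_rat L cf)).1.
    apply: dvdp_nodes => // x xs.
    have := dvdp_sub (hcf' x xs) (hcf x xs).
    by congr (_ %| _); ring.
  rewrite size_prod_XsubC leqNgt ltnS (leq_trans (size_polyD _ _)) //.
  rewrite geq_max size_polyN !(leq_trans (size_laurent_num _ _)) //; lia.
suff [p [szp pal] hp] : exists2 p : {poly CC},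
    (size p <= L.*2.-1)%N /\ ((0 < L)%N -> revp L.-1.*2 p = p) &
    {in s, forall x, ('X - (y x ^+ 2)%:P) ^+ count_mem x s %| p - H x}.
  pose cf := laurent_coef L (fun i => p`_i).
  have cfE : (polys_of_rat (laurent_rat L cf)).1 = p by exact: laurent_num_coef.
  have cfP : pseudospline_conditions k Gam Gt th cf.
    split; [|split].
    - move=> z /eqP z0; case: (posnP L) => [L0|L_gt0].
        have p0 : p = 0 by apply/eqP; rewrite -size_poly_leq0 (leq_trans szp) // L0.
        by rewrite !reval_CC cfE p0 !horner0 !mul0r.
      by apply: (reval_laurent_inv L_gt0 z0); rewrite cfE pal.
    - by move=> n; exact: laurent_coef_out.
    - by apply/condP; rewrite cfE.
  by exists cf; split=> // cf'; exact: uniq.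
(* For L = 0 the multiset [Gt] is empty, [L.*2.-1] truncates to 0, and the zero polynomial is the
   solution. *)
case: (posnP L) => [L0|L_gt0].
  have s0 : s = [::] by apply: size0nil; lia.
  by exists 0; [rewrite size_poly0 L0 | rewrite s0].
have cnt_opp (x : CC) : count_mem (Copp x : CC) s = count_mem x s.
  have /permP/(_ (pred1 (Copp x : CC))) <- := Gt_opp.
  rewrite count_map; apply: eq_count => u /=.
  exact: (eqr_opp (u : CC) x).
have H_sqr : {in s, forall x, ('X - (y x ^+ 2)%:P) ^+ count_mem x s %|
    (H x * Q) ^+ 2 - 4%:R * 'X ^+ (N + L.-1.*2)}.
  move=> x xs; have [hV /(_ xs) hT] := hVT x.
  apply: (jet_target_sqr (e := e) _ (y0 x) sizeN) hT.
  exact: power_jet_sqr (cnt_gt0 x xs) hV.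
have H_val : {in s, forall x, (H x * Q).[y x ^+ 2] = 2%:R * y x ^+ (N + L.-1.*2)}.
  move=> x xs; have [hV /(_ xs) hT] := hVT x.
  apply: (jet_target_val (e := e) _ (y0 x) sizeN (cnt_gt0 x xs)) hT.
  exact: power_jet_val (cnt_gt0 x xs) hV.
have size_s : size s = L.-1.*2.+1 \/
    size s = L.-1.*2.+2 /\ \prod_(x <- s) y x ^+ 2 = 1.
  (* Odd M is 2L - 1 and even M is 2L; in the even case the nodes multiply to 1 because their
     exponents cancel in pairs. *)
  case: (boolP e) sizeL => _ /= sizeL; [left; lia | right; split; first lia].
  apply: etrans (prod_ex_eq1 k.+1 Gt_opp); rewrite -[RHS](perm_big _ Gt_opp) big_map.
  by apply: eq_bigr => x _; rewrite sqrt_node_sqr.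
have [p [szp pal] hp] := exists_palindromic_interpolant pchar_CC cnt_opp y0
  (sqrt_node_opp k) z_inj (size_Ginv_den k Gam th) (revp_Ginv_den k th G_opp)
  Qz H_sqr H_val size_s.
by exists p => //; split=> //; apply: leq_trans szp _; lia.
Qed.

End PseudoSpline.

Theorem mainTheorem8
  (k : nat) (Gam Gt : list Cplx) (ths : list Cplx) (ts : list nat) (th : Cplx)
  (HG : sym_descr Gam ths ts) (Hth : In th ths)
  (HN2 : (2 <= length Gam)%nat)
  (HGt : symmetric_multiset Gt) (Hsub : sub_multiset Gt Gam)
  (HMN : (length Gt <= length Gam)%nat)
  (Hpar : Nat.even (length Gt) = Nat.even (length Gam)) :
  let N := length Gam in
  let L := ceil_half (length Gt) in
  let Grat := Ginv_rat k Gam th in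
  let P := fun cf : Z -> Cplx =>
    (forall z, z <> C0 -> reval (laurent_rat L cf) z = reval (laurent_rat L cf) (Cinv z)) /\
    (forall n : Z, (n < - Z.of_nat L + 1 \/ Z.of_nat L - 1 < n)%Z -> cf n = C0) /\
    (forall vth : Cplx, forall s : nat, (s < mult vth Gt)%nat ->
       let zl := ex (S k) (Copp vth) in
       reval (rderiv_n s (laurent_rat L cf)) zl =
       Csum_upto s (fun i =>
         Cmul (RtoC (Binomial.C s i))
              (Cmul (v_coef k N vth i) (reval (rderiv_n (s - i) Grat) zl)))) in
  exists cf : Z -> Cplx, P cf /\ (forall cf', P cf' -> forall n, cf' n = cf n).
Proof.
  apply PseudoSpline.exists_unique_pseudospline; trivial.
  - now exists ths, ts.
  - apply Kconst_neq_C0.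
    + destruct HG as (_ & _ & Hc & _); rewrite Forall_forall in Hc.
      now apply canon_snd_bounds, Hc.
    + apply symmetric_multiset_in_strip; now exists ths, ts.
Qed.
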